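(* Let $\{X_n\}_{n\in\mathbb Z}$ be a stationary and ergodic finitarily Markovian process with values in a finite or countably infinite alphabet $\mathcal X$, let $0<\gamma<1$, and let $\chi_n$ be a fixed consistent backward estimator of the memory length (see context). Let $\epsilon>0$ be fixed and let $\mathcal N$, $\kappa_n$, $\rho_n^i$ be as constructed in the context. Then: (i) almost surely, $\rho_n^{\kappa_n}=K(X_{-\infty}^n)$ for all sufficiently large $n\in\mathcal N$; (ii) almost surely, $$\liminf_{n\to\infty}\frac{|\mathcal N\cap\{0,1,\dots,n-1\}|}{n}\ge 1-\epsilon;$$ (iii) almost surely, for all sufficiently large $n\in\mathcal N$, the string $X_{n-\rho_n^{\kappa_n}+1}^n$ appears at least $n^{1-\gamma}$ times in $X_0^n$.
   Context: Notation: $X_m^n=(X_m,\dots,X_n)$ for $m\le n$, and $X_m^n$ is the empty string if $m>n$; similarly for other strings. $p(x_{-k}^0)=P(X_{-k}^0=x_{-k}^0)$ and $p(y|x_{-k}^0)=P(X_1=y\mid X_{-k}^0=x_{-k}^0)$; for the empty string $\emptyset$, $p(\emptyset)=1$ and $p(y|\emptyset)=P(X_1=y)$. Memory length: $K(X_{-\infty}^0)$ is the smallest $0\le K<\infty$ such that for all $i\ge1$, $y\in\mathcal X$, $z_{-K-i+1}^{-K}\in\mathcal X^i$ one has $p(y|X_{-K+1}^0)=p(y|z_{-K-i+1}^{-K},X_{-K+1}^0)$ provided $p(z_{-K-i+1}^{-K},X_{-K+1}^0,y)>0$; $K(X_{-\infty}^0)=\infty$ if there is no such $K$. $K(X_{-\infty}^n)$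 is the same function applied to the past of time $n$ (i.e. to the shifted sequence). The process is finitarily Markovian if $K(X_{-\infty}^0)<\infty$ almost surely. Consistent backward estimator: a sequence of nonnegative integer valued functions $\chi_n=\chi_n(X_{-n}^0)$, $n\ge 0$, such that for every stationary ergodic finitarily Markovian process with values in $\mathcal X$, almost surely $\chi_n(X_{-n}^0)=K(X_{-\infty}^0)$ for all sufficiently large $n$. When $\chi_n$ is applied to a left-infinite sequence it depends only on its last $n+1$ symbols. Construction: for $i=0,1,2,\dots$ set $\zeta_{-1}(i)=-i$, $\zeta_0(i)=0$ and for $n\ge1$ $$\zeta_n(i)=\zeta_{n-1}(i)+\min\{t>0: X_{i+\zeta_{n-1}(i)-(n-1)+t}^{i+\zeta_{n-1}(i)+t}=X_{i+\zeta_{n-1}(i)-(n-1)}^{i+\zeta_{n-1}(i)}\}.$$ Define $\tilde X_{-n}(i)=X_{i+\zeta_n(i)-n}$ for $n\ge0$, which gives a process $\{\tilde X_n(i)\}_{n=-\infty}^0$; write $\tilde X_{-m}^0(i)=(\tilde X_{-m}(i),\dots,\tilde X_0(i))$. Let $\eta_n(i)=\max\{j\ge-1: i+\zeta_j(i)\le n\}$. Put $\rho_n^i=\chi_{\eta_n(i)}(\tilde X_{-\infty}^0(i))$ if $\eta_n(i)\ge0$ and $\rho_n^i=0$ otherwise; this is a function of $X_0^n$. Let $$A_n^i=\{\rho_n^i\le j\le n: X_{j-\rho_n^i+1}^j=\tilde X_{-\rho_n^i+1}^0(i)\}.$$ Let $\theta_n=\theta_n(\epsilon)$ be the minimal $j$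 such that $\left|\bigcup_{i\le j}A_n^i\right|/n\ge1-\epsilon/2$. Let $\mathcal N$ be the (random) set of those $n$ for which $n\in\bigcup_{i\le\theta_n}A_n^i$, and for such $n$ let $\kappa_n=\min\{i\ge0:\tilde X_{-\rho_n^i+1}^0(i)=X_{n-\rho_n^i+1}^n\}$. *)

(* Defs.v *)
From HB Require Import structures.
From mathcomp Require Import all_boot all_order all_algebra.
From mathcomp Require Import all_classical all_reals all_analysis.

Set Implicit Arguments.
Unset Strict Implicit.
Unset Printing Implicit Defensive.

Import Order.TTheory GRing.Theory Num.Theory.
Local Open Scope classical_set_scope.
Local Open Scope ring_scope.

(** Smallest natural number satisfying [Q]; [None] stands for [+oo], the minimum
    of the empty set. *)
Definition omin (Q : nat -> Prop) : option nat :=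
  match pselect (exists n, `[< Q n >]) with
  | left exQ => Some (ex_minn exQ)
  | right _ => None
  end.

(** Strings are listed in chronological order: [block x n k] is
    [x_{n-k+1}, ..., x_n], the empty string when [k = 0]. *)
Definition block (S : Type) (x : int -> S) (n : int) (k : nat) : seq S :=
  rev (mkseq (fun j => x (n - j%:Z)) k).

Definition shift_path (S : Type) (m : int) (x : int -> S) : int -> S :=
  fun n => x (n + m).

Section Process.
Context (R : realType) (d : measure_display) (Omega : measurableType d)
  (P : probability Omega R) (S : countType) (X : int -> Omega -> S).

(** [S] carries the discrete sigma-algebra; as [S] is countable, it is enough to
    ask that preimages of points be measurable. *)
Definition measurable_process : Prop :=
  forall (n : int) (a : S), measurable (X n @^-1` [set a]).

Definition path_measurable : set (set (int -> S)) :=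
  <<s [set B | exists (n : int) (a : S), B = [set x | x n = a]] >>.

Definition law (B : set (int -> S)) : \bar R := P [set o | B (X^~ o)].

Definition stationary_process : Prop :=
  forall B, path_measurable B -> law (shift_path 1 @^-1` B) = law B.

Definition ergodic_process : Prop :=
  forall B, path_measurable B -> shift_path 1 @^-1` B = B ->
    law B = 0%E \/ law B = 1%E.

(** [p(w) = P(X_{-k}^0 = w)] where [k + 1 = size w]. *)
Definition pstr (w : seq S) : R :=
  fine (law [set x | block x 0 (size w) = w]).

(** [p(y | w) = P(X_1 = y | X_{-k}^0 = w)]; it is only used where [p(w) > 0]. *)
Definition pcond (y : S) (w : seq S) : R :=
  fine (law [set x | block x 0 (size w) = w /\ x 1 = y]) / pstr w.

Definition memory_bound (x : int -> S) (K : nat) : Prop :=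
  forall (y : S) (z : seq S), (1 <= size z)%N ->
    0 < pstr (rcons (z ++ block x 0 K) y) ->
    pcond y (block x 0 K) = pcond y (z ++ block x 0 K).

(** The memory length [K(x_{-oo}^0)], with [None] for [+oo]. *)
Definition memory_length (x : int -> S) : option nat := omin (memory_bound x).

Definition finitarily_markovian : Prop :=
  {ae P, forall o, memory_length (X^~ o) <> None}.

Definition stationary_ergodic_FM : Prop :=
  [/\ measurable_process, stationary_process, ergodic_process
    & finitarily_markovian].

End Process.

(** [chi n] is only ever evaluated at strings of length [n + 1]. *)
Definition consistent_backward_estimator (R : realType) (S : countType)
    (chi : nat -> seq S -> nat) : Prop :=
  forall (d : measure_display) (Omega : measurableType d)
    (P : probability Omega R) (X : int -> Omega -> S),
  stationary_ergodic_FM P X ->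
  {ae P, forall o, \forall n \near \oo,
    Some (chi n (block (X^~ o) 0 n.+1)) = memory_length P X (X^~ o)}.

Section Construction.
Context (R : realType) (S : countType) (chi : nat -> seq S -> nat).
Variable x : int -> S.

(** [zeta i n] is [zeta_n(i)] for [n >= 0], with [None] for [+oo] (one of the
    strings never recurs, which has probability zero). *)
Fixpoint zeta (i n : nat) : option nat :=
  if n is m.+1 then
    obind (fun s =>
      omap (addn s) (omin (fun t => (0 < t)%N /\
        block x (i + s + t)%N%:Z n = block x (i + s)%N%:Z n)))
      (zeta i m)
  else Some 0%N.

(** [tilde i n] is [tilde X_{-n}(i)]; the value chosen when [zeta_n(i)] is
    infinite is arbitrary. *)
Definition tilde (i n : nat) : S :=
  x ((i + odflt 0 (zeta i n))%N%:Z - n%:Z).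

(** [tilde X_{-k+1}^0(i)]. *)
Definition tilde_block (i k : nat) : seq S := rev (mkseq (tilde i) k).

(** [eta1 n i] is [eta_n(i) + 1]: the index [j = -1] is always admissible, since
    [zeta_{-1}(i) = -i], and gives [0]. As [zeta_j(i) >= j], indices [j > n] are
    never admissible. *)
Definition eta1 (n i : nat) : nat :=
  (\max_(j < n.+1 | if zeta i j is Some s then (i + s <= n)%N else false) j.+1)%N.

Definition rho (n i : nat) : nat :=
  if eta1 n i is m.+1 then chi m (tilde_block i m.+1) else 0%N.

Definition inA (n i j : nat) : bool :=
  (rho n i <= j <= n)%N && (block x j%:Z (rho n i) == tilde_block i (rho n i)).

Definition cardA (n j : nat) : nat :=
  #|[pred l : 'I_n.+1 | [exists i : 'I_j.+1, inA n i l]]|.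

(** For [eps > 0] and [n >= 1] the minimum exists, because [A_n^{n+1}] is all of
    [{0, ..., n}]. *)
Definition theta (eps : R) (n : nat) : nat :=
  odflt 0%N (omin (fun j => 1 - eps / 2 <= (cardA n j)%:R / n%:R)).

Definition inN (eps : R) (n : nat) : bool :=
  [exists i : 'I_(theta eps n).+1, inA n i n].

(** When [n] is in [N] the minimum exists. *)
Definition kappa (n : nat) : nat :=
  odflt 0%N (omin (fun i => tilde_block i (rho n i) = block x n%:Z (rho n i))).

Definition cardN (eps : R) (n : nat) : nat := #|[pred l : 'I_n | inN eps l]|.

(** Number of occurrences of [w] in [x_0^n], counted by their end positions. *)
Definition occurrences (w : seq S) (n : nat) : nat :=
  #|[pred j : 'I_n.+1 | (size w <= j.+1)%N && (block x j%:Z (size w) == w)]|.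

End Construction.

(* Main.v *)
From HB Require Import structures.
Require Import Defs.
From mathcomp Require Import all_boot all_order all_algebra.
From mathcomp Require Import all_classical all_reals all_analysis.
From mathcomp Require Import measurable_realfun.
From mathcomp Require Import zify lra.

Set Implicit Arguments.
Unset Strict Implicit.
Unset Printing Implicit Defensive.

Import Order.TTheory GRing.Theory Num.Theory.
Import numFieldNormedType.Exports.

Local Open Scope classical_set_scope.
Local Open Scope ring_scope.

(** For each starting point [i], the sequence [tilde X(i)] read off the future
    of [X] has the law of the true past of the process.  Indeed
    [zeta_n(i)] moves the path from one occurrence of its last [n] symbols to
    the next one, which is the first-return map of the shift on the cylinder
    of these [n] symbols.  A first-return map preserves the restriction of the
    measure to the set it lives on, and these cylinders partition the space,
    so the moved path is again distributed as the original
    ([measure_induced_map], [measure_stopped_path]).  Its last [n + 1] symbols are the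
    first [n + 1] reconstructed ones ([tilde_block_zeta]), whence equality of
    the laws on the past sigma-algebra ([measure_tilde_path]).  Consistency of
    [chi] on the process therefore gives, almost surely and for every [i], that
    [rho_n^i] is eventually the memory length [K_i] of [tilde X(i)]
    ([ae_tilde_memory], [rho_eventually]).

    Whether [k] is the memory length of a past depends on its last [k] symbols
    alone.  So there is a countable set of memory words, no past ends with two
    of them, and almost every past ends with one.  Finitely many memory words
    of positive probability thus already cover probability more than
    [1 - eps / 2] ([memory_words_exhaust]).  By the ergodic theorem each of
    these is the memory word [w_i] of some reconstructed past
    ([ae_tilde_word_found]), so there is a finite (random) [J] such that
    [w_0, ..., w_J] cover more than [1 - eps / 2].

    Everything else is counting along a single path, with frequencies given by
    the ergodic theorem ([birkhoff]).  Once [rho_n^i = K_i] for all [i <= J],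
    the set [A_n^i] consists of the occurrences of [w_i].  Hence
    [theta_n <= J] eventually, and [theta_n >= j0] eventually, where [j0] is the
    first index at which [w_0, ..., w_j0] have frequency at least
    [1 - eps / 2] ([theta_between]).  Therefore:
    - for [n] in [N], the word picked by [kappa_n] is some [w_i] with
      [i <= J], a memory word that ends the past of [n], so that its length is
      the memory length there;
    - [N] eventually contains all occurrences of [w_0, ..., w_j0], and these
      have density at least [1 - eps / 2];
    - the finitely many [w_i] with [i <= J] have positive frequency, so they
      occur linearly often, which beats [n ^ (1 - gamma)]. *)

(** * Minima of sets of naturals and countable-valued measurable maps *)

Lemma ominSome (W : nat -> Prop) n :
  omin W = Some n <-> W n /\ forall m, (m < n)%N -> ~ W m.
Proof.
rewrite /omin; case: pselect => [exW|nW]; last first.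
  by split=> // -[Wn _]; exfalso; apply: nW; exists n; apply/asboolP.
case: ex_minnP => k /asboolP Wk kmin; split=> [[<-]|[Wn nmin]].
  split=> // m mk Wm.
  by have := kmin m; rewrite leqNgt mk => /(_ (introT (asboolP _) Wm)).
congr Some; apply/eqP; rewrite eqn_leq kmin; last exact/asboolP.
by rewrite andTb leqNgt; apply/negP => /nmin.
Qed.

Lemma ominNone (W : nat -> Prop) : omin W = None <-> forall m, ~ W m.
Proof.
rewrite /omin; case: pselect => [exW|nW]; split=> //.
  by case: exW => n Wn nW; case: (nW n); exact/asboolP.
by move=> _ m Wm; apply: nW; exists m; apply/asboolP.
Qed.

Lemma eq_omin (W W' : nat -> Prop) :
  (forall n, W n <-> W' n) -> omin W = omin W'.
Proof. by move=> WW'; congr omin; apply/funext => n; apply/propext. Qed.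

Section CountableValued.
Context d (T : measurableType d).

(** Measurability for the discrete sigma-algebra on [U].  It is tested on points,
    which is equivalent to it when [U] is countable, and lets every function of the
    path that is defined by blocks be treated by [dmeas_bind]. *)
Definition dmeas (U : Type) (f : T -> U) :=
  forall a, measurable [set x | f x = a].

(** Closure under any measurable construction in which finitely or countably many
    cases are distinguished: decompose over the value of [g]. *)
Lemma dmeas_bind (U : countType) (V : Type) (g : T -> U) (F : U -> T -> V) :
  dmeas g -> (forall b, dmeas (F b)) -> dmeas (fun x => F (g x) x).
Proof.
move=> mg mF a.
rewrite (_ : [set x | _] = \bigcup_b ([set x | g x = b] `&` [set x | F b x = a])).
  apply: countable_bigcupT_measurable => // b.
  by apply: measurableI; [exact: mg|exact: mF].
apply/seteqP; split=> x /=; first by move=> <-; exists (g x).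
by case=> b _ [<-].
Qed.

Lemma dmeas_cst (U : Type) (c : U) : dmeas (fun=> c).
Proof.
move=> a; have [->|ca] := pselect (c = a).
  by rewrite (_ : [set x | _] = setT); [exact: measurableT|apply/seteqP; split].
by rewrite (_ : [set x | _] = set0); [exact: measurable0|apply/seteqP; split].
Qed.

Lemma dmeas_comp (U : countType) (V : Type) (h : U -> V) (g : T -> U) :
  dmeas g -> dmeas (h \o g).
Proof.
by move=> mg; apply: (@dmeas_bind _ _ g (fun b _ => h b)) => // b; exact: dmeas_cst.
Qed.

Lemma dmeas_pair (U V : countType) (f : T -> U) (g : T -> V) :
  dmeas f -> dmeas g -> dmeas (fun x => (f x, g x)).
Proof.
move=> mf mg; apply: (@dmeas_bind _ _ f (fun b x => (b, g x))) => // b.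
exact: (@dmeas_comp _ _ (fun c => (b, c)) g).
Qed.

Lemma dmeas_set (U : countType) (g : T -> U) (A : set U) :
  dmeas g -> measurable [set x | A (g x)].
Proof.
move=> mg; rewrite (_ : [set x | _] = [set x | ((fun b => `[< A b >]) \o g) x = true]).
  exact: dmeas_comp.
by apply/seteqP; split=> x /= /asboolP.
Qed.

Lemma dmeas_omin (W : T -> nat -> Prop) :
  (forall n, measurable [set x | W x n]) -> dmeas (fun x => omin (W x)).
Proof.
move=> mW; have mC n : measurable [set x | ~ W x n].
  rewrite (_ : [set x | _] = ~` [set x | W x n]); last by [].
  exact: measurableC.
case=> [n|].
  rewrite (_ : [set x | _] =
    [set x | W x n] `&` \bigcap_(m in `I_n) [set x | ~ W x m]).
    by apply: measurableI => //; apply: bigcap_measurableType => m _; exact: mC.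
  apply/seteqP; split=> x /=.
    by move=> /ominSome[Wn nW]; split=> // m /= /nW.
  by case=> Wn nW; apply/ominSome; split=> // m /nW.
rewrite (_ : [set x | _] = \bigcap_m [set x | ~ W x m]).
  by apply: bigcapT_measurable => m; exact: mC.
apply/seteqP; split=> x /= => [/ominNone nW m _|nW]; first exact: nW.
by apply/ominNone => m; exact: nW.
Qed.

End CountableValued.

(** * The ergodic theorem for indicator functions *)

Section MeasurePreserving.
Context d (T : measurableType d) (R : realType) (Q : probability T R).
Variable phi : T -> T.
Hypothesis mphi : measurable_fun setT phi.
Hypothesis Qphi : forall B, measurable B -> Q (phi @^-1` B) = Q B.

Let mpre B : measurable B -> measurable (phi @^-1` B).
Proof. by move=> mB; rewrite -[X in measurable X]setTI; exact: mphi. Qed.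

Lemma measurable_iter_preimage k B :
  measurable B -> measurable [set x | B (iter k phi x)].
Proof.
elim: k B => // k IH B mB.
by have := IH _ (mpre mB).
Qed.

Lemma measure_iter_preimage k B :
  measurable B -> Q [set x | B (iter k phi x)] = Q B.
Proof.
elim: k B => // k IH B mB.
by rewrite -(Qphi mB) -(IH _ (mpre mB)).
Qed.

Section Maximal.
Variables (C : set T) (a : R).
Hypotheses (mC : measurable C) (a0 : 0 <= a).

(** The maximum over [m <= n] of the sum of the first [m] terms [\1_C - a] along
    the orbit of [x], with the empty sum included. *)
Fixpoint maxsum n (x : T) : R :=
  if n is m.+1 then Num.max 0 (\1_C x - a + maxsum m (phi x)) else 0.

Lemma maxsum_ge0 n x : 0 <= maxsum n x.
Proof. by case: n => //= n; rewrite le_max lexx. Qed.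

Lemma maxsumS n x : maxsum n x <= maxsum n.+1 x.
Proof.
elim: n x => [|n IH] x; first exact: maxsum_ge0.
by rewrite /= ge_max !le_max lexx/= lerD2l (IH (phi x)) orbT.
Qed.

Lemma maxsum_homo x : {homo maxsum^~ x : m n / (m <= n)%N >-> m <= n}.
Proof. by apply/nondecreasing_seqP => n; exact: maxsumS. Qed.

Lemma measurable_maxsum n : measurable_fun setT (maxsum n).
Proof.
elim: n => [|n IH]; first exact: measurable_cst.
apply: measurable_maxr => //; apply: measurable_funD.
  by apply: measurable_funB => //; exact: measurable_indic.
exact: measurableT_comp.
Qed.

Lemma indicE01 (x : T) : \1_C x = 0 :> R \/ \1_C x = 1 :> R.
Proof. by rewrite indicE; case: (_ \in _); [right|left]. Qed.

Lemma maxsum_le n x : maxsum n x <= n%:R.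
Proof.
elim: n x => // n IH x; rewrite /= ge_max ler0n/= -natr1 addrC lerD ?IH//.
by case: (indicE01 x) => ->; move: a0; lra.
Qed.

Let D n := [set x | 0 < maxsum n x].

Lemma measurable_maxsum_gt0 n : measurable [set x | 0 < maxsum n x].
Proof.
rewrite (_ : [set x | _] = maxsum n @^-1` `]0, +oo[%classic).
  by rewrite -[X in measurable X]setTI; exact: measurable_maxsum.
by apply/seteqP; split=> x /=; rewrite in_itv/= andbT.
Qed.

Let mD n : measurable (D n) := measurable_maxsum_gt0 n.

(** Garsia's inequality: on [D n] the maximum is attained by a nonempty sum, so it
    is at most the first term plus a maximum along the orbit of [phi x].  All
    terms are arranged to be nonnegative, so that it can be integrated in the
    extended reals. *)
Lemma maxsum_step n x :
  maxsum n x + a * \1_(D n) x <= maxsum n (phi x) + \1_C x.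
Proof.
have [Dx|Dx] := boolP (0 < maxsum n x); last first.
  have -> : maxsum n x = 0.
    by apply/le_anti; rewrite maxsum_ge0 andbT leNgt.
  rewrite indicE memNset ?mulr0 ?addr0; last exact/negP.
  by rewrite addr_ge0 ?maxsum_ge0//; case: (indicE01 x) => ->.
rewrite indicE mem_set// mulr1; case: n Dx => [|n]; rewrite ?ltxx// => Dx.
have : maxsum n.+1 x <= \1_C x - a + maxsum n.+1 (phi x).
  apply: (@le_trans _ _ (\1_C x - a + maxsum n (phi x))); last first.
    by rewrite lerD2l maxsumS.
  by move: Dx; rewrite /= lt_max ltxx/= => /ltW/max_idPr ->.
lra.
Qed.

Local Open Scope ereal_scope.

Lemma maxsum_int_fin n : \int[Q]_x (maxsum n x)%:E \is a fin_num.
Proof.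
apply/fin_numPlt/andP; split.
  by apply: (@lt_le_trans _ _ 0) => //; apply: integral_ge0 => x _; rewrite lee_fin maxsum_ge0.
apply: (@le_lt_trans _ _ (\int[Q]_x (n%:R)%:E)).
  apply: ge0_le_integral => //.
  - by move=> x _; rewrite lee_fin maxsum_ge0.
  - by apply/measurable_EFinP; exact: measurable_maxsum.
  - by move=> x _; rewrite lee_fin maxsum_le.
by rewrite integral_cst// -[X in _ * X]/(Q setT) probability_setT mule1 ltry.
Qed.

Lemma maxsum_int_phi n :
  \int[Q]_x (maxsum n (phi x))%:E = \int[Q]_x (maxsum n x)%:E.
Proof.
have := @ge0_integral_pushforward _ _ T T R phi mphi Q setT (EFin \o maxsum n).
rewrite preimage_setT => <-//; last 2 first.
- by apply/measurable_EFinP; exact: measurable_maxsum.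
- by move=> x _ /=; rewrite lee_fin maxsum_ge0.
apply: eq_measure_integral => A mA _; exact: Qphi.
Qed.

(** The two integrals of [maxsum] cancel by invariance of the measure. *)
Lemma maximal_ineq n : a%:E * Q (D n) <= Q C.
Proof.
have mM : measurable_fun setT (fun x => (maxsum n x)%:E).
  by apply/measurable_EFinP; exact: measurable_maxsum.
have mMphi : measurable_fun setT (fun x => (maxsum n (phi x))%:E).
  by apply/measurable_EFinP; apply: measurableT_comp => //; exact: measurable_maxsum.
have mI (A : set T) : measurable A -> measurable_fun setT (fun x => (\1_A x : R)%:E).
  by move=> mA; apply/measurable_EFinP; exact: measurable_indic.
have I0 (A : set T) x : 0 <= (\1_A x : R)%:E by rewrite lee_fin.
have M0 x : 0 <= (maxsum n x)%:E by rewrite lee_fin maxsum_ge0.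
rewrite -(leeD2lE _ _ (maxsum_int_fin n)) -[X in _ <= X + _]maxsum_int_phi.
have <- : \int[Q]_x (a%:E * (\1_(D n) x)%:E) = a%:E * Q (D n).
  rewrite ge0_integralZl//; last exact: mI.
  by rewrite integral_indic// setIT.
have <- : \int[Q]_x (\1_C x)%:E = Q C by rewrite integral_indic// setIT.
rewrite -!ge0_integralD//; last 3 first.
- exact: mI.
- by move=> x _; rewrite mule_ge0.
- by apply: measurable_funeM; exact: mI.
apply: ge0_le_integral => //.
- by move=> x _; rewrite adde_ge0// mule_ge0.
- by apply: emeasurable_funD => //; apply: measurable_funeM; exact: mI.
- by apply: emeasurable_funD => //; exact: mI.
- by move=> x _; rewrite -EFinM -!EFinD lee_fin maxsum_step.
Qed.

Lemma maximal_ergodic : Q (\bigcup_n D n) = 1 -> a%:E <= Q C.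
Proof.
move=> QD; rewrite -[leLHS]mule1 -QD.
have DD : {homo D : n m / (n <= m)%N >-> (n <= m)%O}.
  move=> m n mn; apply/subsetPset => x /= /lt_le_trans; apply; exact: maxsum_homo.
have mUD : measurable (\bigcup_n D n) by exact: bigcupT_measurable.
have cD := nondecreasing_cvg_mu mD mUD DD.
have caD : a%:E * Q (D n) @[n --> \oo] --> a%:E * Q (\bigcup_n D n).
  by apply: cvgeZl => //; exact: cD.
apply: (cvge_le _ caD); apply: nearW => n; exact: maximal_ineq.
Qed.

End Maximal.

Definition visits (C : set T) n (x : T) : nat :=
  (\sum_(k < n) `[< C (iter k phi x) >])%N.

Lemma visitsS C n x : visits C n.+1 x = (`[< C x >] + visits C n (phi x))%N.
Proof.
rewrite /visits big_ord_recl; congr addn.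
by apply: eq_bigr => k _; rewrite /= -iterSr.
Qed.

Lemma visitsC C n x : (visits C n x + visits (~` C) n x = n)%N.
Proof.
rewrite -big_split/= -[RHS]card_ord -sum1_card; apply: eq_bigr => k _.
by case: asboolP => Ck; case: asboolP.
Qed.

Lemma dmeas_phi (U : Type) (f : T -> U) : dmeas f -> dmeas (fun x => f (phi x)).
Proof. by move=> mf a; exact: (mpre (mf a)). Qed.

Lemma dmeas_iter (U : Type) (f : T -> U) k :
  dmeas f -> dmeas (fun x => f (iter k phi x)).
Proof. by move=> mf a; exact: (measurable_iter_preimage k (mf a)). Qed.

Lemma dmeas_asbool (C : set T) : measurable C -> dmeas (fun x => `[< C x >]).
Proof.
move=> mC [].
  by rewrite (_ : [set x | _] = C)//; apply/seteqP; split=> x /asboolP.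
rewrite (_ : [set x | _] = ~` C); first exact: measurableC.
by apply/seteqP; split=> x /=; [move/asboolPn|move=> Cx; exact/asboolPn].
Qed.

Lemma dmeas_visits C n : measurable C -> dmeas (visits C n).
Proof.
move=> mC; elim: n => [|n IH].
  rewrite (_ : visits C 0 = fun=> 0%N); first exact: dmeas_cst.
  by apply/funext => x; rewrite /visits big_ord0.
rewrite (_ : visits C n.+1 =
  (fun p : bool * nat => p.1 + p.2)%N \o (fun x => (`[< C x >], visits C n (phi x)))).
  apply: dmeas_comp; apply: dmeas_pair; first exact: dmeas_asbool.
  exact: (dmeas_phi IH).
by apply/funext => x; rewrite /= visitsS.
Qed.

Lemma visits_maxsum C a n x : (visits C n x)%:R - a * n%:R <= maxsum C a n x.
Proof.
elim: n x => [|n IH] x; first by rewrite /visits big_ord0 mulr0 subr0.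
rewrite visitsS /= le_max; apply/orP; right.
have -> : \1_C x = `[< C x >]%:R :> R.
  by rewrite indicE; case: asboolP => Cx; rewrite ?(mem_set Cx) ?(memNset Cx).
have := IH (phi x); rewrite natrD -natr1; lra.
Qed.

Hypothesis erg : forall B, measurable B -> phi @^-1` B = B -> Q B = 0%E \/ Q B = 1%E.

Section Upper.
Variables (C : set T) (a : R).
Hypotheses (mC : measurable C) (a0 : 0 <= a).

(** The upper density of visits to [C] exceeds [a].  It is phrased with a margin
    [k.+1%:R^-1], which absorbs the one visit gained or lost when
    the orbit is shifted, and makes the set strictly invariant. *)
Definition overvisited := [set x | exists k, forall m, exists2 n,
  (m <= n)%N & (a + k.+1%:R^-1) * n%:R < (visits C n x)%:R].

Lemma measurable_overvisited : measurable overvisited.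
Proof.
rewrite (_ : overvisited = \bigcup_k \bigcap_m \bigcup_(n in [set n | (m <= n)%N])
    [set x | (a + k.+1%:R^-1) * n%:R < (visits C n x)%:R]).
  apply: bigcupT_measurable => k; apply: bigcapT_measurable => m.
  apply: bigcup_measurable => n _.
  exact: (@dmeas_set _ _ _ (visits C n) [set v | (a + k.+1%:R^-1) * n%:R < v%:R]
    (dmeas_visits n mC)).
apply/seteqP; split=> x /=.
  by case=> k kx; exists k => // m _; have [n mn nx] := kx m; exists n.
by case=> k _ kx; exists k => m; have [n /= mn nx] := kx m I; exists n.
Qed.

Lemma overvisited_invariant : phi @^-1` overvisited = overvisited.
Proof.
(* One margin is split in two: one half remains, the other pays for the shift. *)
have half k : exists k', k.+1%:R^-1 = k'.+1%:R^-1 + k'.+1%:R^-1 :> R /\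
    0 < k'.+1%:R^-1 :> R.
  exists (k.*2.+1)%N; split; last by rewrite invr_gt0.
  have -> : k.*2.+2%:R = 2 * k.+1%:R :> R by rewrite -natrM mul2n doubleS.
  by rewrite invfM -mulrDl (_ : 2^-1 + 2^-1 = 1 :> R) ?mul1r//; lra.
have big (d' : R) m : 0 < d' -> exists N, (m <= N)%N /\
    forall n, (N <= n)%N -> a + 1 + d' <= d' * n%:R.
  move=> d0; exists (maxn m (Num.bound ((a + 1 + d') / d'))); split; first exact: leq_maxl.
  move=> n; rewrite geq_max => /andP[_ Bn].
  rewrite -ler_pdivrMl// mulrC; apply: (@le_trans _ _ (Num.bound ((a + 1 + d') / d'))%:R).
    by apply/ltW/archi_boundP; rewrite divr_ge0 ?(ltW d0)// !addr_ge0// ltW.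
  by rewrite ler_nat.
apply/seteqP; split=> x /= [k]; have [k' [-> d0]] := half k => kx; exists k' => m.
  have [N [mN Nbig]] := big _ m d0.
  have [n Nn nx] := kx N; exists n.+1; first by rewrite (leq_trans mN)// leqW.
  have {}nx : (a + (k'.+1%:R^-1 + k'.+1%:R^-1)) * n%:R < (visits C n.+1 x)%:R.
    by rewrite visitsS natrD; apply: (lt_le_trans nx); rewrite lerDr ler0n.
  apply: le_lt_trans nx; have := Nbig n Nn; rewrite -[n.+1%:R]natr1.
  move: (k'.+1%:R^-1) d0 => d' d0; nra.
have [N [mN Nbig]] := big _ m d0.
have [[//|n] Nn] := kx N.+1; rewrite visitsS natrD => nx.
exists n; first by rewrite (leq_trans mN).
have := Nbig n Nn; move: nx; rewrite -[n.+1%:R]natr1.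
have : `[< C x >]%:R <= 1 :> R by case: `[< _ >].
move: (k'.+1%:R^-1) d0 a0 => d' d0 a_ge0 Cx1 nx Nn2; nra.
Qed.

(** If the set had full measure, almost every orbit would have a partial sum of
    [\1_C - a] that is positive, and the maximal inequality would give [a <= Q C]. *)
Lemma overvisited_null : (Q C < a%:E)%E -> Q overvisited = 0%E.
Proof.
move=> QCa; have [//|E1] := erg measurable_overvisited overvisited_invariant.
suff : (a%:E <= Q C)%E by rewrite leNgt QCa.
apply: maximal_ergodic => //.
have mU : measurable (\bigcup_n [set x | 0 < maxsum C a n x]).
  by apply: bigcupT_measurable => n; exact: measurable_maxsum_gt0.
apply/le_anti/andP; split; first exact: probability_le1.
rewrite -E1; apply: le_measure; rewrite ?inE//; first exact: measurable_overvisited.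
move=> x [k kx]; have [n n1 nx] := kx 1%N; exists n => //=.
apply: lt_le_trans (visits_maxsum C a n x); rewrite subr_gt0; apply: le_lt_trans nx.
by rewrite ler_wpM2r// lerDl.
Qed.

End Upper.

Lemma visits_upper (C : set T) : measurable C ->
  {ae Q, forall x, forall e, 0 < e ->
    \forall n \near \oo, (visits C n x)%:R <= (fine (Q C) + e) * n%:R}.
Proof.
move=> mC; have QC0 : 0 <= fine (Q C) by rewrite fine_ge0.
pose a j : R := fine (Q C) + j.+1%:R^-1.
have : {ae Q, forall x, forall j, ~ overvisited C (a j) x}.
  apply: ae_foralln => j; exists (overvisited C (a j)); split.
  - exact: measurable_overvisited.
  - apply: overvisited_null => //; first by rewrite addr_ge0.
    by rewrite -[X in (X < _)%E]fineK ?fin_num_measure// lte_fin ltrDl.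
  - by move=> x /contrapT.
apply: filterS => x nx e e0.
have [j je] : exists j, j.+1%:R^-1 + j.+1%:R^-1 <= e.
  exists (Num.bound (2 / e)); set m := Num.bound _.
  have : 2 / e < m%:R by apply: archi_boundP; rewrite divr_ge0 ?ltW.
  rewrite ltr_pdivrMr// => me; rewrite -mulr2n -[_ *+ 2]mulr_natl.
  by rewrite ler_pdivrMr// -natr1; nra.
have [m mx] : exists m, forall n, (m <= n)%N ->
    (visits C n x)%:R <= (a j + j.+1%:R^-1) * n%:R.
  apply: contrapT => nm; apply: (nx j); exists j => m; apply: contrapT => mn.
  apply: nm; exists m => n mn'; rewrite leNgt; apply/negP => ?; apply: mn.
  by exists n.
near=> n; apply: (@le_trans _ _ ((a j + j.+1%:R^-1) * n%:R)).
  by apply: mx; near: n; exact: nbhs_infty_ge.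
by rewrite ler_wpM2r// /a -addrA lerD2l.
Unshelve. all: by end_near. Qed.

(** The lower bound is the upper bound for the complement of [C]. *)
Lemma birkhoff (C : set T) : measurable C ->
  {ae Q, forall x, (visits C n x)%:R / n%:R @[n --> \oo] --> fine (Q C)}.
Proof.
move=> mC; have := visits_upper (measurableC mC); have := visits_upper mC.
apply: filterS2 => x Cx C'x; apply/cvgrPdist_le => e e0.
near=> n.
have n0 : 0 < n%:R :> R by rewrite ltr0n; near: n; exact: nbhs_infty_gt.
rewrite ler_distlC ler_pdivrMr// ler_pdivlMr// andbC; apply/andP; split.
  by near: n; exact: Cx.
have : (visits (~` C) n x)%:R <= (fine (Q (~` C)) + e) * n%:R by near: n; exact: C'x.
rewrite probability_setC// fineB ?fin_num_measure//=.
have : (visits C n x)%:R + (visits (~` C) n x)%:R = n%:R :> R.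
  by rewrite -natrD visitsC.
nra.
Unshelve. all: by end_near. Qed.

End MeasurePreserving.

(** * First-return maps preserve the measure *)

Section FirstReturn.
Context d (T : measurableType d) (R : realType) (Q : probability T R).
Variable phi : T -> T.
Hypothesis mphi : measurable_fun setT phi.
Hypothesis Qphi : forall B, measurable B -> Q (phi @^-1` B) = Q B.

Lemma measure_le_by_levels (U : countType) (f : T -> U) (B V : set T) :
  dmeas f -> measurable B -> measurable V ->
  (forall a, (Q (B `&` [set x | f x = a]) <= Q (V `&` [set x | f x = a]))%E) ->
  (Q B <= Q V)%E.
Proof.
move=> mf mB mV BV.
pose L n := [set x | pickle (f x) = n].
have mL n : measurable (L n) by exact: (dmeas_set [set a | pickle a = n] mf).
have levels (A : set T) : measurable A ->
    Q A = (\sum_(0 <= n <oo) Q (A `&` L n))%E.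
  move=> mA; rewrite -(@measure_semi_bigcup _ _ _ Q (fun n => A `&` L n)).
  - rewrite -setI_bigcupr (_ : \bigcup_n L n = setT) ?setIT//.
    by apply/seteqP; split=> x // _; exists (pickle (f x)).
  - by move=> n; exact: measurableI.
  - apply/trivIsetP => i j _ _ /eqP ij; apply/seteqP; split=> x //=.
    by rewrite /L/= => -[[_ xi] [_ xj]]; apply: ij; rewrite -xi.
  - by apply: bigcupT_measurable => n; exact: measurableI.
rewrite (levels _ mB) (levels _ mV); apply: lee_nneseries => // n _.
case: (pselect (exists a : U, pickle a = n)) => [[a an]|na].
  have -> : L n = [set x | f x = a]; last exact: BV.
  apply/seteqP; split=> x; rewrite /L/= -an; last by move=> ->.
  exact: (pcan_inj pickleK).
rewrite (_ : B `&` L n = set0) ?measure0//.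
by apply/seteqP; split=> x //= -[_ xn]; apply: na; exists (f x).
Qed.

Section OneLevel.
Variables (B C : set T).
Hypotheses (mB : measurable B) (mC : measurable C).

Definition first_entry n := [set x |
  [/\ forall k, (k < n)%N -> ~ C (iter k phi x), C (iter n phi x) & B (iter n phi x)]].

Lemma measurable_first_entry n : measurable (first_entry n).
Proof.
rewrite (_ : first_entry n = \bigcap_(k in `I_n) ~` [set x | C (iter k phi x)] `&`
  ([set x | C (iter n phi x)] `&` [set x | B (iter n phi x)])).
  apply: measurableI.
    apply: bigcap_measurableType => k _; apply: measurableC.
    exact: measurable_iter_preimage.
  by apply: measurableI; exact: measurable_iter_preimage.
by apply/seteqP; split=> x /=; [case|case=> ? []].
Qed.

(** Pulling a first entry at time [n] back by [phi] gives either a point of [C],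
    which then returns to [C] at time [n + 1], or a first entry at time [n + 1].
    Iteration splits the measure of [B `&` C] into the measures of
    the sets of first return at time [1, ..., n], and a remainder. *)
Lemma measure_first_entryS n :
  Q (first_entry n) = (Q (C `&` phi @^-1` first_entry n) + Q (first_entry n.+1))%E.
Proof.
have mH := measurable_first_entry.
have mpH : measurable (phi @^-1` first_entry n).
  exact: (measurable_iter_preimage mphi 1 (mH n)).
rewrite -(Qphi (mH n)) (measureDI _ mpH mC) addeC; congr (_ + Q _)%E; first by rewrite setIC.
apply/seteqP; split=> x /=.
  move=> [[nH Cx Bx] nCx]; split; rewrite ?iterSr//.
  by case=> [|k] //; rewrite ltnS iterSr; exact: nH.
move=> [nH Cx Bx]; split; last exact: (nH 0%N).
split; rewrite -?iterSr// => k kn; rewrite -iterSr; exact: nH.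
Qed.

(** These sets lie in decreasing sets with empty intersection: an orbit that has
    not entered [C] before time [n] for any [n] never does. *)
Lemma first_entry_cvg0 : Q (first_entry n) @[n --> \oo] --> 0%E.
Proof.
pose G n := [set x | (forall k, (k < n)%N -> ~ C (iter k phi x)) /\
                     exists2 m, (n <= m)%N & C (iter m phi x)].
have mG n : measurable (G n).
  rewrite (_ : G n = \bigcap_(k in `I_n) ~` [set x | C (iter k phi x)] `&`
    \bigcup_(m in [set m | (n <= m)%N]) [set x | C (iter m phi x)]).
    apply: measurableI.
      apply: bigcap_measurableType => k _; apply: measurableC.
      exact: measurable_iter_preimage.
    by apply: bigcup_measurable => m _; exact: measurable_iter_preimage.
  by [].
have mIG : measurable (\bigcap_n G n) by exact: bigcapT_measurable.
have IG0 : \bigcap_n G n = set0.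
  apply/seteqP; split=> x //= Gx; have [_ [m _ Cm]] := Gx 0%N I.
  by have [/(_ m (ltnSn m))] := Gx m.+1 I.
have : Q (G n) @[n --> \oo] --> 0%E.
  rewrite -[X in _ --> X](measure0 Q) -IG0.
  apply: nonincreasing_cvg_mu => //; first exact: (le_lt_trans (probability_le1 _ _) (ltry 1)).
  move=> m n mn; apply/subsetPset => x [nC [l nl Cl]]; split.
    by move=> k km; apply: nC; exact: leq_trans km mn.
  by exists l => //; exact: leq_trans mn nl.
apply: (@squeeze_cvge _ _ _ _ (fun=> 0%E)); last exact: cvg_cst.
apply: nearW => n; rewrite measure_ge0/=; apply: le_measure; rewrite ?inE//.
  exact: measurable_first_entry.
by move=> x [nC Cn _]; split=> //; exists n.
Qed.

(** [C `&` phi @^-1` first_entry n] is the set of points of [C] that return to [C] for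
    the first time at time [n + 1], in [B]; any [V] containing these sets is at least as
    large as their disjoint union, whose measure is that of [B `&` C]. *)
Lemma first_return_measure_le (V : set T) : measurable V ->
  (forall n, C `&` phi @^-1` first_entry n `<=` V) ->
  (Q (B `&` C) <= Q V)%E.
Proof.
move=> mV EV; pose E n := C `&` phi @^-1` first_entry n.
have mE n : measurable (E n).
  apply: measurableI => //; exact: (measurable_iter_preimage mphi 1 (measurable_first_entry n)).
have H0 n : Q (B `&` C) = (\sum_(k < n) Q (E k) + Q (first_entry n))%E.
  elim: n => [|n IH].
    rewrite big_ord0 add0e; congr (Q _); apply/seteqP; split=> x /=; by case.
  by rewrite IH big_ord_recr/= -addeA -measure_first_entryS.
have EQ n : (\sum_(k < n) Q (E k) <= Q V)%E.
  rewrite -measure_bigsetU//; last first.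
    apply/trivIsetP => i j _ _ ij; apply/seteqP; split=> x //= [[_ [Hi Ci _]] [_ [Hj Cj _]]].
    by move: ij; rewrite neq_ltn => /orP[/Hj|/Hi].
  apply: le_measure; rewrite ?inE//; first by apply: bigsetU_measurable.
  by rewrite -bigcup_mkord => x [k _ /EV].
have : (Q V + Q (first_entry n))%E @[n --> \oo] --> (Q V + 0)%E.
  apply: cvgeD; [exact: fin_num_adde_defl|exact: cvg_cst|exact: first_entry_cvg0].
rewrite adde0; apply: cvge_ge; apply: nearW => n.
by rewrite (H0 n) leeD2r.
Qed.

End OneLevel.

Section Induced.
Variables (U : countType) (f : T -> U).
Hypothesis mf : dmeas f.

(** The return time to the level set of [f] that contains the starting point. *)
Definition first_return x :=
  omin (fun t => (0 < t)%N /\ f (iter t phi x) = f x).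

Definition induced_map x := iter (odflt 0%N (first_return x)) phi x.

Lemma dmeas_first_return : dmeas first_return.
Proof.
apply: dmeas_omin => n.
apply: (@dmeas_set _ _ _ (fun x => (f (iter n phi x), f x))
  [set p | (0 < n)%N /\ p.1 = p.2]).
by apply: dmeas_pair => //; exact: dmeas_iter.
Qed.

Lemma measurable_induced_preimage B :
  measurable B -> measurable (induced_map @^-1` B).
Proof.
move=> mB; have := @dmeas_bind _ _ _ _ first_return
  (fun r x => `[< B (iter (odflt 0%N r) phi x) >]) dmeas_first_return.
move=> /(_ _ true)H; rewrite (_ : _ @^-1` _ = [set x |
  `[< B (iter (odflt 0%N (first_return x)) phi x) >] = true]).
  by apply: H => r; apply: dmeas_asbool; exact: measurable_iter_preimage.
by apply/seteqP; split=> x /= /asboolP.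
Qed.

(** A first return stays in its level set, so the estimate holds on each level and
    can be summed.  The finiteness of the return time is kept on the right: for
    [B] the whole space this is recurrence.  Applied to complements as well, the
    inequality becomes the equality [measure_induced_map]. *)
Lemma measure_le_induced B : measurable B ->
  (Q B <= Q (induced_map @^-1` B `&` [set x | first_return x <> None]))%E.
Proof.
move=> mB; have mR : measurable [set x | first_return x <> None].
  exact: (dmeas_set [set r | r <> None] dmeas_first_return).
have miB := measurable_induced_preimage mB.
apply: (measure_le_by_levels mf) => // [|a]; first exact: measurableI.
apply: first_return_measure_le => //; first by apply: measurableI => //; exact: measurableI.
move=> n x [fx]; rewrite /first_entry/= -!iterSr => -[nC Cn Bn].
have rx : first_return x = Some n.+1.
  apply/ominSome; split; first by rewrite Cn fx.
  case=> [|m] mn [//= _]; rewrite fx => fm.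
  by apply: (nC m mn); rewrite -iterSr.
by do !split=> //; rewrite /induced_map rx.
Qed.

Lemma measure_induced_map B : measurable B -> Q (induced_map @^-1` B) = Q B.
Proof.
have le A : measurable A -> (Q A <= Q (induced_map @^-1` A))%E.
  move=> mA; apply: (le_trans (measure_le_induced mA)).
  apply: le_measure; rewrite ?inE//; last exact: measurable_induced_preimage.
  apply: measurableI; first exact: measurable_induced_preimage.
  exact: (dmeas_set [set r | r <> None] dmeas_first_return).
move=> mB; apply/le_anti/andP; split; last exact: le.
have := le _ (measurableC mB); rewrite preimage_setC !probability_setC//.
  rewrite -[Q B]fineK ?fin_num_measure// -[Q (induced_map @^-1` B)]fineK; last first.
    by rewrite fin_num_measure//; exact: measurable_induced_preimage.
  by rewrite -!EFinB !lee_fin lerD2l lerN2.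
exact: measurable_induced_preimage.
Qed.

Lemma first_return_finite : {ae Q, forall x, first_return x <> None}.
Proof.
have mR : measurable [set x | first_return x <> None].
  exact: (dmeas_set [set r | r <> None] dmeas_first_return).
apply/negligibleP; first exact: measurableC.
rewrite [LHS]probability_setC//.
suff -> : Q [set x | first_return x <> None] = 1%E by rewrite subee.
apply/le_anti/andP; split; first exact: probability_le1.
have := measure_le_induced measurableT; rewrite preimage_setT setTI.
by rewrite -[X in (X <= _)%E]/(Q setT) probability_setT.
Qed.

End Induced.
End FirstReturn.

(** * Strings, shifts and the reconstructed past *)

Section Blocks.
Variable S : countType.
Implicit Types x y : int -> S.

Lemma size_block x n k : size (block x n k) = k.
Proof. by rewrite size_rev size_mkseq. Qed.

Lemma blockS x n k : block x n k.+1 = x (n - k%:Z) :: block x n k.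
Proof. by rewrite /block mkseqS rev_rcons. Qed.

Lemma block_shift m x n k : block (shift_path m x) n k = block x (n + m) k.
Proof.
by rewrite /block; congr rev; apply: eq_mkseq => j; rewrite /shift_path addrAC.
Qed.

Lemma block_suffix x n y m j k :
  (j <= k)%N -> block x n k = block y m k -> block x n j = block y m j.
Proof.
move=> jk; rewrite -(subnK jk); elim: (k - j)%N => // l IH.
by rewrite addSn !blockS => -[_ /IH].
Qed.

Lemma shift_path_comp m n x : shift_path m (shift_path n x) = shift_path (m + n) x.
Proof. by apply/funext => k; rewrite /shift_path addrA. Qed.

Lemma iter_shift k x : iter k (shift_path 1) x = shift_path k%:Z x.
Proof.
elim: k => [|k IH]; first by apply/funext => n; rewrite /shift_path addr0.
by rewrite iterS IH shift_path_comp -PoszD add1n.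
Qed.

Lemma tilde_blockS x i k :
  tilde_block x i k.+1 = tilde x i k :: tilde_block x i k.
Proof. by rewrite /tilde_block mkseqS rev_rcons. Qed.

Lemma size_tilde_block x i k : size (tilde_block x i k) = k.
Proof. by rewrite size_rev size_mkseq. Qed.

Lemma zetaS x i n : zeta x i n.+1 =
  obind (fun s => omap (addn s) (omin (fun t => (0 < t)%N /\
        block x (i + s + t)%N%:Z n.+1 = block x (i + s)%N%:Z n.+1))) (zeta x i n).
Proof. by []. Qed.

Lemma zeta_shift x i n : zeta (shift_path i%:Z x) 0 n = zeta x i n.
Proof.
elim: n => // n IH; rewrite !zetaS IH; congr obind; apply/funext => s.
congr omap; apply: eq_omin => t; rewrite !block_shift.
by rewrite -!PoszD !add0n addnC addnA (addnC s i).
Qed.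

Lemma tilde_shift x i n : tilde (shift_path i%:Z x) 0 n = tilde x i n.
Proof.
rewrite /tilde zeta_shift /shift_path; congr x.
by rewrite add0n addrAC -PoszD addnC.
Qed.

Lemma tilde_block_shift x i k : tilde_block (shift_path i%:Z x) 0 k = tilde_block x i k.
Proof. by congr rev; apply: eq_mkseq => n; exact: tilde_shift. Qed.

(** By construction each jump of [zeta] lands on a copy of the string already
    read, so the string read at the [n]-th landing point extends it by the symbol
    preceding that copy. *)
Lemma tilde_block_zeta x i n s : zeta x i n = Some s ->
  tilde_block x i n.+1 = block x (i + s)%N%:Z n.+1.
Proof.
elim: n s => [|n IH] s.
  by move=> [<-]; rewrite tilde_blockS blockS /tilde.
move=> zs; rewrite tilde_blockS blockS /tilde zs/=; congr cons.
move: zs; rewrite zetaS; case zn: (zeta x i n) => [u|]//=.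
case rt: (omin _) => [t|]//= [<-]; move/ominSome : rt => [[_ rt] _].
by rewrite addnA rt; exact: IH.
Qed.

(** The reconstructed past as a two-sided sequence, reflected to positive times so
    that no default symbol is required. *)
Definition tilde_path x : int -> S := fun n => tilde x 0 `|n|%N.

Lemma block_tilde_path x k : block (tilde_path x) 0 k = tilde_block x 0 k.
Proof. by congr rev; apply: eq_mkseq => j; rewrite /tilde_path sub0r abszN. Qed.

End Blocks.

(** Sequences with the sigma-algebra [path_measurable].  The symbol [s0] makes the
    type pointed, as measurable types are. *)
Definition path_space (S : countType) (s0 : S) := int -> S.

Section PathSpace.
Variables (S : countType) (s0 : S).

HB.instance Definition _ := gen_eqMixin (path_space s0).
HB.instance Definition _ := gen_choiceMixin (path_space s0).
HB.instance Definition _ := isPointed.Build (path_space s0) (fun=> s0).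

Let path_measurableC (A : set (path_space s0)) :
  @path_measurable S A -> @path_measurable S (~` A).
Proof. exact: (@sigma_algebraC (path_space s0)). Qed.

HB.instance Definition _ := @isMeasurable.Build default_measure_display
  (path_space s0) (@path_measurable S)
  (@sigma_algebra0 _ setT _) path_measurableC (@sigma_algebra_bigcup _ setT _).

Local Notation PS := (path_space s0).

Lemma dmeas_coord n : dmeas (fun x : PS => x n).
Proof. by move=> a; apply: sub_sigma_algebra; exists n, a. Qed.

Lemma dmeas_block n k : dmeas (fun x : PS => block x n k).
Proof.
elim: k => [|k IH]; first exact: dmeas_cst.
have -> : (fun x : PS => block x n k.+1) =
   (fun p : S * seq S => p.1 :: p.2) \o (fun x : PS => (x (n - k%:Z), block x n k)).
  by apply/funext => x; rewrite blockS.
by apply: dmeas_comp; apply: dmeas_pair => //; exact: dmeas_coord.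
Qed.

Lemma dmeas_zeta i n : dmeas (fun x : PS => zeta x i n).
Proof.
elim: n => [|n IH]; first exact: dmeas_cst.
pose F b (x : PS) := obind (fun s => omap (addn s) (omin (fun t => (0 < t)%N /\
        block x (i + s + t)%N%:Z n.+1 = block x (i + s)%N%:Z n.+1))) b.
apply: (@dmeas_bind _ _ _ _ (fun x : PS => zeta x i n) F) => // -[s|]; last exact: dmeas_cst.
apply: (@dmeas_comp _ _ _ _ (omap (addn s))); apply: dmeas_omin => t.
apply: (@dmeas_set _ _ _
  (fun x : PS => (block x (i + s + t)%N%:Z n.+1, block x (i + s)%N%:Z n.+1))
  [set p | (0 < t)%N /\ p.1 = p.2]).
by apply: dmeas_pair; exact: dmeas_block.
Qed.

Lemma dmeas_tilde i n : dmeas (fun x : PS => tilde x i n).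
Proof.
apply: (@dmeas_bind _ _ _ _ (fun x : PS => zeta x i n)
  (fun b (x : PS) => x ((i + odflt 0 b)%N%:Z - n%:Z))); first exact: dmeas_zeta.
by move=> b; exact: dmeas_coord.
Qed.

Lemma dmeas_tilde_block i k : dmeas (fun x : PS => tilde_block x i k).
Proof.
elim: k => [|k IH]; first exact: dmeas_cst.
have -> : (fun x : PS => tilde_block x i k.+1) =
   (fun p : S * seq S => p.1 :: p.2) \o (fun x : PS => (tilde x i k, tilde_block x i k)).
  by apply/funext => x; rewrite tilde_blockS.
by apply: dmeas_comp; apply: dmeas_pair => //; exact: dmeas_tilde.
Qed.

Lemma measurable_into_path d (T : measurableType d) (f : T -> PS) :
  (forall n, dmeas (fun t => f t n)) -> measurable_fun setT f.
Proof.
move=> mf; pose G : set (set PS) :=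
  [set B | exists (n : int) (a : S), B = [set x | x n = a]].
apply: (@measurability _ _ T PS setT f G) => //.
by move=> _ [_ [n [a ->]] <-]; rewrite setTI; exact: mf.
Qed.

Lemma measurable_shift m : measurable_fun setT (shift_path m : PS -> PS).
Proof. by apply: measurable_into_path => n; exact: dmeas_coord. Qed.

Lemma measurable_tilde_path : measurable_fun setT (@tilde_path S : PS -> PS).
Proof. by apply: measurable_into_path => n; exact: dmeas_tilde. Qed.

End PathSpace.

(** * The law of the reconstructed past *)

Section AlmostEverywhere.
Context d (T : measurableType d) (R : realType) (Q : probability T R).

Lemma ae_forall_count (U : countType) (W : U -> T -> Prop) :
  (forall u, {ae Q, forall x, W u x}) -> {ae Q, forall x, forall u, W u x}.
Proof.
move=> aeW.
have : {ae Q, forall x, forall n, if unpickle n is Some u then W u x else True}.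
  by apply: ae_foralln => n; case: (unpickle n) => [u|]; [exact: aeW|exact: nearW].
by apply: filterS => x Wx u; have := Wx (pickle u); rewrite pickleK.
Qed.

Lemma ae_probability1 (A : set T) :
  measurable A -> {ae Q, forall x, A x} -> Q A = 1%E.
Proof.
move=> mA /(measure_negligible (measurableC mA)) QA0.
rewrite -[A]setCK probability_setC; last exact: measurableC.
by rewrite [X in (_ - X)%E]QA0 sube0.
Qed.

Lemma ae_iff_measure (A B : set T) : measurable A -> measurable B ->
  {ae Q, forall x, A x <-> B x} -> Q A = Q B.
Proof.
move=> mA mB [N [mN N0 AB]].
have le (A' B' : set T) : measurable A' -> measurable B' ->
    A' `<=` B' `|` N -> (Q A' <= Q B')%E.
  move=> mA' mB' A'B'; rewrite -(measureU0 mB' mN N0).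
  by apply: le_measure; rewrite ?inE//; exact: measurableU.
apply/le_anti/andP; split; apply: le => // x Ax; have [Nx|nNx] := pselect (N x); try (by right).
  by left; apply/(contrapT (fun h => nNx (AB x h))).
by left; apply/(contrapT (fun h => nNx (AB x h))).
Qed.

End AlmostEverywhere.

Section PathLaw.
Variables (S : countType) (s0 : S) (R : realType).
Local Notation PS := (path_space s0).
Local Notation T := (shift_path 1 : PS -> PS).
Variable Q : probability PS R.
Hypothesis QT : forall B, measurable B -> Q (T @^-1` B) = Q B.

Let mT : measurable_fun setT T := measurable_shift 1.

Lemma ae_shift (W : PS -> Prop) :
  {ae Q, forall x : PS, W x} -> {ae Q, forall x : PS, forall i : nat, W (shift_path i%:Z x)}.
Proof.
move=> [N [mN N0 WN]]; apply: ae_foralln => i.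
exists [set x | N (iter i T x)]; split.
- exact: measurable_iter_preimage.
- exact: (etrans (measure_iter_preimage mT QT i mN) N0).
- by move=> x /= nW; rewrite iter_shift; exact: WN.
Qed.

(** The path seen from the random time [zeta_n(0)], as a composition of
    first-return maps for strings of growing length; see
    [ae_zeta_stopped_path]. *)
Definition stopped_path (n : nat) : PS -> PS :=
  iteri n (fun m V x => induced_map T (fun y : PS => block y 0 m.+1) (V x)) id.

Lemma measurable_stopped_path n B :
  measurable B -> measurable (stopped_path n @^-1` B).
Proof.
elim: n B => // n IH B mB.
by have := IH _ (measurable_induced_preimage mT (dmeas_block s0 0 n.+1) mB).
Qed.

Lemma measure_stopped_path n B :
  measurable B -> Q (stopped_path n @^-1` B) = Q B.
Proof.
elim: n B => // n IH B mB.
have mI := measurable_induced_preimage mT (dmeas_block s0 0 n.+1) mB.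
by rewrite -[RHS](measure_induced_map mT QT (dmeas_block s0 0 n.+1))// -(IH _ mI).
Qed.

Lemma ae_zeta_stopped_path : {ae Q, forall x : PS, forall n, exists2 s,
  zeta x 0 n = Some s & stopped_path n x = shift_path s%:Z x}.
Proof.
have : {ae Q, forall x : PS, forall n,
    first_return T (fun y : PS => block y 0 n.+1) (stopped_path n x) <> None}.
  apply: ae_foralln => n.
  have [N [mN N0 fN]] := first_return_finite mT QT (dmeas_block s0 0 n.+1).
  exists (stopped_path n @^-1` N); split.
  - exact: measurable_stopped_path.
  - exact: (etrans (measure_stopped_path n mN) N0).
  - by move=> x /= /fN.
apply: filterS => x ret; elim=> [|n [s zs vs]].
  by exists 0%N => //; apply/funext => k; rewrite /shift_path addr0.
have := ret n; case rt: (first_return _ _ _) => [t|]// _.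
exists (s + t)%N; last first.
  rewrite /stopped_path iteriS -/(stopped_path n) /induced_map rt /= vs.
  by rewrite iter_shift shift_path_comp -PoszD addnC.
rewrite zetaS zs /= (_ : omin _ = Some t)//.
rewrite -rt; apply: eq_omin => u.
by rewrite vs iter_shift !block_shift !add0r !add0n -PoszD addnC.
Qed.

Lemma ae_zeta_finite : {ae Q, forall x : PS, forall i n, zeta x i n <> None}.
Proof.
have := ae_shift ae_zeta_stopped_path; apply: filterS => x zx i n.
by rewrite -zeta_shift; have [s ->] := zx i n.
Qed.

Lemma measure_tilde_block k (W : set (seq S)) :
  Q [set x | W (tilde_block x 0 k)] = Q [set x | W (block x 0 k)].
Proof.
case: k => [//|n].
have mW : measurable [set x : PS | W (block x 0 n.+1)].
  exact: (dmeas_set W (dmeas_block s0 0 n.+1)).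
rewrite -[RHS](measure_stopped_path n)//; apply: ae_iff_measure.
- exact: (dmeas_set W (dmeas_tilde_block s0 0 n.+1)).
- exact: measurable_stopped_path.
have := ae_zeta_stopped_path; apply: filterS => x /(_ n)[s zs vs].
by rewrite /= (tilde_block_zeta zs) vs block_shift add0r.
Qed.

(** Events that depend on finitely many past symbols; a pi-system generating the
    sigma-algebra of the past. *)
Definition past_event : set (set PS) :=
  [set B | exists k (W : set (seq S)), B = [set x | W (block x 0 k)]].

Lemma measure_tilde_path E : <<s past_event >> E ->
  Q (@tilde_path S @^-1` E) = Q E.
Proof.
move=> pE; pose tildeM := isMeasurableFun.Build _ _ PS PS (@tilde_path S)
  (measurable_tilde_path (s0 := s0)).
pose tildeF : {mfun PS >-> PS} := HB.pack (@tilde_path S : PS -> PS) tildeM.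
pose Q' : {measure set PS -> \bar R} := distribution Q tildeF.
rewrite -[LHS]/(Q' E).
apply: (@g_sigma_algebra_measure_unique _ _ _ past_event _ (fun=> setT) _ _ Q' Q) => //.
- by move=> _ [k [W ->]]; exact: (dmeas_set W (dmeas_block s0 0 k)).
- by move=> _; exists 0%N, setT; apply/seteqP.
- by apply/seteqP; split=> // x _; exists 0%N.
- move=> _ _ [k [W ->]] [l [W' ->]]; exists (maxn k l), [set w | exists y : PS,
    [/\ block y 0 (maxn k l) = w, W (block y 0 k) & W' (block y 0 l)]].
  apply/seteqP; split=> x /=; first by move=> [Wx W'x]; exists x.
  move=> [y [yx Wy W'y]].
  by rewrite -(block_suffix (leq_maxl k l) yx) -(block_suffix (leq_maxr k l) yx).
- move=> _ [k [W ->]]; apply: etrans (measure_tilde_block k W).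
  rewrite -[LHS]/(Q [set x : PS | W (block (tilde_path x) 0 k)]); congr (Q _).
  by apply/seteqP; split=> x; rewrite /= block_tilde_path.
- by move=> _; rewrite [X in (X < _)%E]probability_setT ltry.
Qed.

End PathLaw.

(** * Frequencies of words and memory words *)

Section Words.
Variables (S : countType) (s0 : S) (R : realType).
Local Notation PS := (path_space s0).
Local Notation T := (shift_path 1 : PS -> PS).

Definition hits (F : seq (seq S)) (x : int -> S) (l : int) : bool :=
  has (fun w => block x l (size w) == w) F.

Definition hit_count F x n : nat := (\sum_(l < n) hits F x l%:Z)%N.

Definition hit_event F : set PS := [set x | hits F x 0].

Lemma hits_shift F x m l : hits F (shift_path m x) l = hits F x (l + m).
Proof. by apply: eq_has => w; rewrite block_shift. Qed.

Lemma hits1 w x l : hits [:: w] x l = (block x l (size w) == w).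
Proof. by rewrite /hits /= orbF. Qed.

Lemma dmeas_hits F : dmeas (fun x : PS => hits F x 0).
Proof.
elim: F => [|w F IH]; first exact: dmeas_cst.
apply: (@dmeas_comp _ _ _ _ (fun p => (p.1 == w) || p.2)
  (fun x : PS => (block x 0 (size w), hits F x 0))).
by apply: dmeas_pair => //; exact: dmeas_block.
Qed.

Lemma measurable_hit_event F : measurable (hit_event F).
Proof. exact: (dmeas_hits F true). Qed.

Variable Q : probability PS R.
Hypothesis QT : forall B, measurable B -> Q (T @^-1` B) = Q B.
Hypothesis ergT : forall B, measurable B -> T @^-1` B = B -> Q B = 0%E \/ Q B = 1%E.

Let mT : measurable_fun setT T := measurable_shift 1.

Definition word_freq F : R := fine (Q (hit_event F)).

Lemma ae_hit_count_freq : {ae Q, forall x : PS, forall F,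
  (hit_count F x n)%:R / n%:R @[n --> \oo] --> word_freq F}.
Proof.
apply: (ae_forall_count (U := seq (seq S))) => F.
have := birkhoff mT QT ergT (measurable_hit_event F).
apply: filterS => x xF; rewrite (_ : (fun n => _) =
  fun n => (visits T (hit_event F) n x)%:R / n%:R); first exact: xF.
apply/funext => n; congr (_%:R / _); apply: eq_bigr => l _.
rewrite iter_shift /hit_event/=.
by rewrite hits_shift add0r asboolb.
Qed.

Lemma word_freq_homo F F' : {subset F <= F'} -> word_freq F <= word_freq F'.
Proof.
move=> FF'; apply: fine_le; rewrite ?fin_num_measure//; try exact: measurable_hit_event.
apply: le_measure; rewrite ?inE//; try exact: measurable_hit_event.
by move=> x /= /hasP[w /FF' wF' wx]; apply/hasP; exists w.
Qed.

Lemma hit_event1 w : hit_event [:: w] = [set x | block x 0 (size w) = w].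
Proof. by apply/seteqP; split=> x; rewrite /hit_event /hits /= orbF => /eqP. Qed.

Lemma measure_tilde_word w :
  Q [set x : PS | tilde_block x 0 (size w) = w] = Q (hit_event [:: w]).
Proof. by rewrite hit_event1; exact: (measure_tilde_block QT (size w) [set v | v = w]). Qed.

Lemma word_freq_eq0 F : ~~ (0 < word_freq F) -> Q (hit_event F) = 0%E.
Proof.
rewrite lt0r fine_ge0// andbT negbK => /eqP F0.
by rewrite -[LHS]fineK ?[fine _]F0// fin_num_measure//; exact: measurable_hit_event.
Qed.

Lemma ae_tilde_word_freq_gt0 : {ae Q, forall x : PS, forall i k,
  0 < word_freq [:: tilde_block x i k]}.
Proof.
have : {ae Q, forall x : PS, forall w, tilde_block x 0 (size w) = w -> 0 < word_freq [:: w]}.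
  apply: (ae_forall_count (U := seq S)) => w.
  have [w0|/word_freq_eq0 w0] := boolP (0 < word_freq [:: w]); first exact: nearW.
  exists [set x : PS | tilde_block x 0 (size w) = w]; split.
  - exact: (dmeas_tilde_block s0 0 (size w) w).
  - exact: etrans (measure_tilde_word w) w0.
  - by move=> x /= /not_implyP[].
move=> /(ae_shift QT); apply: filterS => x wx i k.
by apply: (wx i); rewrite tilde_block_shift size_tilde_block.
Qed.

(** If [tilde_block x i (size w)] differed from [w] for all [i], the orbit of [x]
    would never visit an event which has, by equality of the laws, the positive
    probability of [w]. *)
Lemma ae_tilde_word_found : {ae Q, forall x : PS, forall w,
  0 < word_freq [:: w] -> exists i, tilde_block x i (size w) = w}.
Proof.
apply: (ae_forall_count (U := seq S)) => w.
have := birkhoff mT QT ergT (dmeas_tilde_block s0 0 (size w) w).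
apply: filterS => x xw w0; apply: contrapT => nw.
suff : fine (Q [set x : PS | tilde_block x 0 (size w) = w]) = 0.
  by move=> Q0; move: w0; rewrite /word_freq -measure_tilde_word Q0 ltxx.
apply: (cvg_unique _ xw) => //; apply: cvg_near_cst; apply: nearW => n.
rewrite /visits big1 ?mul0r// => l _; case: asboolP => //=.
by rewrite iter_shift tilde_block_shift => lw; case: nw; exists l.
Qed.

Section Memory.
(** [is_memory x k] stands for the equality of the memory length of [x] to [k],
    through the two properties on which the argument rests: it is decided by the
    last [k] symbols of the past of [x], and [k] is unique. *)
Variable is_memory : (int -> S) -> nat -> Prop.
Hypothesis is_memory_block : forall x y k,
  block x 0 k = block y 0 k -> is_memory x k -> is_memory y k.
Hypothesis is_memory_inj : forall x k l, is_memory x k -> is_memory x l -> k = l.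

Definition memory_word (w : seq S) :=
  exists2 x, block x 0 (size w) = w & is_memory x (size w).

Lemma memory_wordP x k : memory_word (block x 0 k) <-> is_memory x k.
Proof.
rewrite /memory_word size_block; split=> [[y yx]|]; first exact: is_memory_block.
by exists x.
Qed.

Lemma measurable_is_memory k : measurable [set x : PS | is_memory x k].
Proof.
rewrite (_ : [set x : PS | _] = [set x : PS | memory_word (block x 0 k)]).
  exact: (dmeas_set memory_word (dmeas_block s0 0 k)).
by apply/seteqP; split=> x /memory_wordP.
Qed.

Lemma measurable_estimate_correct (chi : nat -> seq S -> nat) :
  measurable [set x : PS | \forall n \near \oo, is_memory x (chi n (block x 0 n.+1))].
Proof.
rewrite (_ : [set x : PS | _] = \bigcup_m \bigcap_(n in [set n | (m <= n)%N])
    [set x : PS | `[< is_memory x (chi n (block x 0 n.+1)) >] = true]).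
  apply: bigcupT_measurable => m; apply: bigcap_measurableType => n _.
  apply: (@dmeas_bind _ _ _ _ (fun x : PS => chi n (block x 0 n.+1))
    (fun k (x : PS) => `[< is_memory x k >])); last first.
    by move=> k; exact: dmeas_asbool (measurable_is_memory k).
  exact: (dmeas_comp (chi n) (dmeas_block s0 0 n.+1)).
apply/seteqP; split=> x /= [m _ mx]; exists m => // n /= mn.
  exact/asboolP/mx.
by have /asboolP := mx n mn.
Qed.

Lemma tilde_memory_word_inj x i k l :
  memory_word (tilde_block x i k) -> memory_word (tilde_block x i l) -> k = l.
Proof.
rewrite -(tilde_block_shift x i k) -(tilde_block_shift x i l) -!block_tilde_path.
move=> /memory_wordP + /memory_wordP.
exact: is_memory_inj.
Qed.

(** The events that the past ends with a memory word of positive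
    probability, among the first [n] words of an enumeration, increase to a set of
    full measure. *)
Lemma memory_words_exhaust e : {ae Q, forall x : PS, exists k, is_memory x k} -> 0 < e ->
  exists F, (forall w, w \in F -> memory_word w /\ 0 < word_freq [:: w]) /\
            1 - e < word_freq F.
Proof.
move=> ae_is_memory e0.
pose good w := `[< memory_word w /\ 0 < word_freq [:: w] >].
pose F n := [seq w <- pmap (@pickle_inv (seq S)) (iota 0 n) | good w].
have inF n w : (w \in F n) = good w && (pickle w < n)%N.
  rewrite mem_filter; congr andb; rewrite mem_pmap; apply/mapP/idP => [[m]|wn].
    rewrite mem_iota/= add0n => mn mw; have := @pickle_invK (seq S) m.
    by rewrite -mw /= => ->.
  by exists (pickle w); rewrite ?mem_iota ?pickleK_inv.
have FF : {homo (fun n => hit_event (F n)) : n m / (n <= m)%N >-> (n <= m)%O}.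
  move=> m n mn; apply/subsetPset => x /= /hasP[w]; rewrite inF => /andP[gw wm] wx.
  by apply/hasP; exists w => //; rewrite inF gw (leq_trans wm).
have mUF : measurable (\bigcup_n hit_event (F n)).
  by apply: bigcupT_measurable => n; exact: measurable_hit_event.
have QU : Q (\bigcup_n hit_event (F n)) = 1%E.
  apply: ae_probability1 => //.
  have : {ae Q, forall x : PS, forall w, block x 0 (size w) = w -> 0 < word_freq [:: w]}.
    apply: (ae_forall_count (U := seq S)) => w.
    have [w0|/word_freq_eq0 w0] := boolP (0 < word_freq [:: w]); first exact: nearW.
    exists (hit_event [:: w]); split=> //; first exact: measurable_hit_event.
    by move=> x /= /not_implyP[wx _]; rewrite hit_event1.
  apply: filterS2 ae_is_memory => x [k xk] xpos.
  exists (pickle (block x 0 k)).+1 => //; apply/hasP.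
  exists (block x 0 k); last by rewrite size_block.
  rewrite inF ltnSn andbT; apply/asboolP; split; first exact/memory_wordP.
  by apply: xpos; rewrite size_block.
have cF := nondecreasing_cvg_mu (mu := Q) (fun n => measurable_hit_event (F n)) mUF FF.
have : \forall n \near \oo, ((1 - e)%:E < Q (hit_event (F n)))%E.
  have QUe : ((1 - e)%:E < Q (\bigcup_n hit_event (F n)))%E by rewrite QU lte_fin; lra.
  exact: (cF [set u | ((1 - e)%:E < u)%E] (open_ereal_gt' QUe)).
move=> [n _ /(_ n (leqnn n)) nF]; exists (F n); split.
  by move=> w; rewrite inF => /andP[/asboolP].
by rewrite -lte_fin fineK// fin_num_measure//; exact: measurable_hit_event.
Qed.

(** Eventual correctness of [chi] is an event of the past, hence has the same
    probability for the reconstructed past as for the process itself. *)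
Lemma ae_tilde_memory (chi : nat -> seq S -> nat) :
  {ae Q, forall x : PS, \forall n \near \oo, is_memory x (chi n (block x 0 n.+1))} ->
  {ae Q, forall x : PS, forall i, exists2 k, memory_word (tilde_block x i k) &
    \forall n \near \oo, chi n (tilde_block x i n.+1) = k}.
Proof.
move=> aechi.
pose stable k m := \bigcap_(n in [set n | (m <= n)%N]) [set x : PS | chi n (block x 0 n.+1) = k]
  `&` [set x : PS | memory_word (block x 0 k)].
pose G := \bigcup_k \bigcup_m stable k m.
have pG : <<s @past_event S s0 >> G.
  rewrite -[<<s _ >>]/(@measurable _ (g_sigma_algebraType (@past_event S s0))).
  apply: bigcupT_measurable => k; apply: bigcupT_measurable => m; apply: measurableI.
    apply: bigcap_measurableType => n _; apply: sub_sigma_algebra.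
    by exists n.+1, [set w | chi n w = k].
  by apply: sub_sigma_algebra; exists k, memory_word.
have mG : measurable G.
  apply: (smallest_sub (@sigma_algebra_measurable _ PS) _ pG) => _ [k [W ->]].
  exact: (dmeas_set W (dmeas_block s0 0 k)).
have QG : Q G = 1%E.
  apply: ae_probability1 => //; apply: filterS aechi => x [m _ mx].
  exists (chi m (block x 0 m.+1)) => //; exists m => //; split; last first.
    by apply/memory_wordP; exact: (mx m (leqnn m)).
  by move=> n /= mn; apply: (@is_memory_inj x); [exact: mx|exact: (mx m (leqnn m))].
have mtG : measurable (@tilde_path S @^-1` G : set PS).
  rewrite -[X in measurable X]setTI.
  exact: (measurable_tilde_path (s0 := s0)).
have : {ae Q, forall x : PS, G (tilde_path x)}.
  apply/negligibleP; first exact: measurableC.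
  have := probability_setC Q mtG; rewrite measure_tilde_path// QG subee//.
move=> /(ae_shift QT); apply: filterS => x Gx i.
have [k _ [m _ [chix kx]]] := Gx i.
exists k; first by move: kx; rewrite /= block_tilde_path tilde_block_shift.
exists m => // n /= mn; have := chix n mn.
by rewrite /= block_tilde_path tilde_block_shift.
Qed.

End Memory.
End Words.

(** * Counting along one path *)

Section Counting.

Lemma card_ord_pred n (b : nat -> bool) : #|[pred l : 'I_n | b l]| = (\sum_(l < n) b l)%N.
Proof. by rewrite -sum1_card big_mkcond; apply: eq_bigr => l _; rewrite inE; case: (b l). Qed.

(** Used to compare counts of sets that agree outside an initial segment, which
    is harmless for frequencies. *)
Lemma sum_bool_le (a b : nat -> bool) c n :
  (forall l, (l < n)%N -> (c <= l)%N -> a l -> b l) ->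
  (\sum_(l < n) a l <= \sum_(l < n) b l + c)%N.
Proof.
move=> ab; apply: (@leq_trans (\sum_(l < n) b l + minn n c)%N); last first.
  by rewrite leq_add2l geq_minr.
elim: n ab => [|n IH] ab; first by rewrite !big_ord0.
rewrite !big_ord_recr/=; have {}IH := IH (fun l ln => ab l (ltnW ln)).
have := ab n (ltnSn n).
case: (a n) => [|_]; last by move: IH; case: (b n) => /=; lia.
by case: (leqP c n) => [cn /(_ isT isT) ->|nc _]; move: IH; case: (b n) => /=; lia.
Qed.

Lemma near_forall_lt (W : nat -> nat -> Prop) J :
  (forall j, \forall n \near \oo, W j n) ->
  \forall n \near \oo, forall j, (j < J)%N -> W j n.
Proof.
move=> nW; elim: J => [|J IH]; first exact: nearW.
apply: filterS2 IH (nW J) => n WJ WJn j.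
by rewrite ltnS leq_eqVlt => /predU1P[->|/WJ].
Qed.

Variable R : realType.

Lemma frequency_gt (u v : nat -> nat) (l a : R) c :
  (u n)%:R / n%:R @[n --> \oo] --> l -> a < l ->
  (\forall n \near \oo, (u n <= v n + c)%N) ->
  \forall n \near \oo, a * n%:R < (v n)%:R.
Proof.
move=> ul al uv; pose b := (a + l) / 2.
have bl : b < l by rewrite /b; lra.
have ab : 0 < b - a by rewrite /b; lra.
near=> n.
have n0 : 0 < n%:R :> R by rewrite ltr0n; near: n; exact: nbhs_infty_gt.
have un : b * n%:R < (u n)%:R.
  by rewrite -ltr_pdivlMr//; near: n; exact: (cvgr_gt l ul).
have uvn : (u n)%:R <= (v n)%:R + c%:R :> R by rewrite -natrD ler_nat; near: n.
have : c%:R <= (b - a) * n%:R.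
  by rewrite -ler_pdivrMl//; near: n; exact: nbhs_infty_ger.
lra.
Unshelve. all: by end_near. Qed.

Lemma frequency_lt (u v : nat -> nat) (l a : R) c :
  (u n)%:R / n%:R @[n --> \oo] --> l -> l < a ->
  (\forall n \near \oo, (v n <= u n + c)%N) ->
  \forall n \near \oo, (v n)%:R < a * n%:R.
Proof.
move=> ul al uv; pose b := (a + l) / 2.
have bl : l < b by rewrite /b; lra.
have ab : 0 < a - b by rewrite /b; lra.
near=> n.
have n0 : 0 < n%:R :> R by rewrite ltr0n; near: n; exact: nbhs_infty_gt.
have un : (u n)%:R < b * n%:R.
  by rewrite -ltr_pdivrMr//; near: n; exact: (cvgr_lt l ul).
have uvn : (v n)%:R <= (u n)%:R + c%:R :> R by rewrite -natrD ler_nat; near: n.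
have : c%:R <= (a - b) * n%:R.
  by rewrite -ler_pdivrMl//; near: n; exact: nbhs_infty_ger.
lra.
Unshelve. all: by end_near. Qed.

Lemma powR_sublinear (g a : R) : 0 < g -> 0 < a ->
  \forall n \near \oo, n%:R `^ (1 - g) <= a * n%:R.
Proof.
move=> g0 a0; near=> n.
have n0 : 0 < n%:R :> R by rewrite ltr0n; near: n; exact: nbhs_infty_gt.
rewrite powRD; last by rewrite (gt_eqF n0) implybT.
rewrite powRr1 ?ler0n// mulrC ler_pM2r// powRN.
rewrite invf_ple ?posrE ?powR_gt0//.
apply: (@le_trans _ _ ((a^-1 `^ g^-1) `^ g)).
  by rewrite -powRrM mulVf ?gt_eqF// powRr1// invr_ge0 ltW.
apply: ge0_ler_powR; rewrite ?nnegrE ?powR_ge0// ?ltW//.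
by near: n; exact: nbhs_infty_gtr.
Unshelve. all: by end_near. Qed.

Lemma limn_einf_ge (u : nat -> R) (a : R) :
  (\forall n \near \oo, a <= u n) -> (a%:E <= limn_einf (fun n => (u n)%:E))%E.
Proof.
move=> [N _ uN]; rewrite limn_einf_lim; apply: lime_ge; first exact: is_cvg_einfs.
exists N => // n /= Nn; apply: le_ereal_inf_tmp => _ [k /= nk <-].
by rewrite lee_fin; apply: uN => /=; exact: leq_trans nk.
Qed.

End Counting.

(** * Asymptotics of the scheme along one path *)

Section Scheme.
Variables (S : countType) (R : realType) (chi : nat -> seq S -> nat) (x : int -> S).
Variables (eps : R) (K : nat -> nat) (freq : seq (seq S) -> R).
Hypothesis eps0 : 0 < eps.
Hypothesis zeta_finite : forall i n, zeta x i n <> None.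
Hypothesis chiK : forall i, \forall n \near \oo, chi n (tilde_block x i n.+1) = K i.
Hypothesis freqP : forall F, (hit_count F x n)%:R / n%:R @[n --> \oo] --> freq F.

Let word i := tilde_block x i (K i).
Let words j := [seq word i | i <- iota 0 j.+1].

Hypothesis freq_word_gt0 : forall i, 0 < freq [:: word i].
Variable J : nat.
Hypothesis freq_words_J : 1 - eps / 2 < freq (words J).

Lemma hits_wordsP j l :
  reflect (exists2 i, (i <= j)%N & block x l (K i) = word i) (hits (words j) x l).
Proof.
apply: (iffP hasP) => [[_ /mapP[i ij ->]]|[i ij il]].
  by move: ij; rewrite size_tilde_block mem_iota ltnS => ij /eqP; exists i.
exists (word i); last by rewrite size_tilde_block il.
by apply/mapP; exists i => //; rewrite mem_iota ltnS.
Qed.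

Lemma rho_eventually i : \forall n \near \oo, rho chi x n i = K i.
Proof.
have [N _ KN] := chiK i.
case zN: (zeta x i N) (zeta_finite (i := i) (n := N)) => [s|]// _.
exists (maxn N (i + s)) => // n; rewrite /= geq_max => /andP[Nn isn].
have : (N < eta1 x n i)%N.
  rewrite /eta1; apply: (bigop.bigmax_sup (Ordinal (Nn : (N < n.+1)%N))) => //=.
  by rewrite zN isn.
by rewrite /rho; case: (eta1 _ _ _) => // m /KN.
Qed.

Lemma rho_upto : \forall n \near \oo, forall i, (i <= J)%N -> rho chi x n i = K i.
Proof.
apply: (near_forall_lt (W := fun i n => rho chi x n i = K i) J.+1).
exact: rho_eventually.
Qed.

Let Kmax := \max_(i < J.+1) K i.

Let leKmax i : (i <= J)%N -> (K i <= Kmax)%N.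
Proof. by move=> iJ; rewrite /Kmax (leq_bigmax (Ordinal (iJ : (i < J.+1)%N))). Qed.

Lemma cardA_hit_count j : (j <= J)%N -> \forall n \near \oo,
  (hit_count (words j) x n <= cardA chi x n j + Kmax)%N /\
  (cardA chi x n j <= hit_count (words j) x n + 1)%N.
Proof.
move=> jJ; apply: filterS rho_upto => n rhoK.
rewrite /cardA (card_ord_pred n.+1 (fun l => [exists i : 'I_j.+1, inA chi x n i l])).
split.
  apply: (@leq_trans (hit_count (words j) x n.+1)).
    by rewrite /hit_count big_ord_recr leq_addr.
  apply: (sum_bool_le (a := fun l : nat => hits (words j) x l%:Z)
    (b := fun l : nat => [exists i : 'I_j.+1, inA chi x n i l])).
  move=> l ln Kl /hits_wordsP[i ij il].
  apply/existsP; exists (Ordinal (ij : (i < j.+1)%N)).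
  have iJ := leq_trans ij jJ.
  by rewrite /inA/= rhoK// il eqxx andbT (leq_trans (leKmax iJ) Kl).
apply: (@leq_trans (hit_count (words j) x n.+1)); last first.
  by rewrite /hit_count big_ord_recr leq_add2l leq_b1.
rewrite -[leqRHS]addn0.
apply: (sum_bool_le (a := fun l : nat => [exists i : 'I_j.+1, inA chi x n i l])
  (b := fun l : nat => hits (words j) x l%:Z)) => l _ _ /existsP[i].
have iJ : (i <= J)%N by rewrite (leq_trans _ jJ)// -ltnS.
rewrite /inA rhoK// => /andP[_ /eqP il]; apply/hits_wordsP.
by exists i => //; rewrite -ltnS.
Qed.

Let dense j := 1 - eps / 2 <= freq (words j).

(** [theta_n] may oscillate when some frequency equals [1 - eps / 2] exactly, so it is
    only squeezed between two bounds. *)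
Lemma theta_between j0 : (forall j, (j < j0)%N -> ~~ dense j) ->
  \forall n \near \oo, (j0 <= theta chi x eps n <= J)%N.
Proof.
move=> j0min.
have j0J : (j0 <= J)%N by rewrite leqNgt; apply/negP => /j0min; rewrite /dense ltW.
have below : \forall n \near \oo, forall j, (j < j0)%N ->
    (cardA chi x n j)%:R < (1 - eps / 2) * n%:R :> R.
  apply: filterS (near_forall_lt (W := fun j n => (j < j0)%N ->
    (cardA chi x n j)%:R < (1 - eps / 2) * n%:R) j0 _) => [n nj j jj0|]; first exact: nj.
  move=> j; have [jj0|jj0] := ltnP j j0; last first.
    exact: nearW.
  have jJ := leq_trans (ltnW jj0) j0J.
  have jlt : freq (words j) < 1 - eps / 2 by rewrite ltNge j0min.
  have : \forall n \near \oo, (cardA chi x n j <= hit_count (words j) x n + 1)%N.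
    by apply: filterS (cardA_hit_count jJ) => n [].
  by move=> /(frequency_lt (@freqP (words j)) jlt); apply: filterS.
have above : \forall n \near \oo, (1 - eps / 2) * n%:R < (cardA chi x n J)%:R :> R.
  apply: (frequency_gt (@freqP (words J)) freq_words_J (c := Kmax)).
  by apply: filterS (cardA_hit_count (leqnn J)) => n [].
near=> n.
have n0 : 0 < n%:R :> R by rewrite ltr0n; near: n; exact: nbhs_infty_gt.
have lo : forall j, (j < j0)%N -> (cardA chi x n j)%:R < (1 - eps / 2) * n%:R :> R.
  by near: n.
have hi : (1 - eps / 2) * n%:R < (cardA chi x n J)%:R :> R by near: n.
rewrite /theta; case om: (omin _) => [t|]; last first.
  by move/ominNone : om => /(_ J); rewrite ler_pdivlMr// ltW.
move/ominSome : om => /= [tn tmin]; rewrite leqNgt [(t <= J)%N]leqNgt.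
apply/andP; split; apply/negP.
  by move=> /lo; rewrite ltNge -ler_pdivlMr// tn.
by move=> /tmin; rewrite ler_pdivlMr// ltW.
Unshelve. all: by end_near. Qed.

(** As [n] is in [A_n^i] for some [i <= theta_n <= J], the minimum defining
    [kappa_n] is at most [J], where [rho] is already the true memory length. *)
Lemma kappa_eventually : \forall n \near \oo, inN chi x eps n ->
  exists i, [/\ (i <= J)%N, kappa chi x n = i, rho chi x n i = K i
              & block x n%:Z (K i) = word i].
Proof.
have := theta_between (j0 := 0) (fun _ => ltac:(by [])).
apply: filterS2 rho_upto => n rhoK /andP[_ thJ] /existsP[i /andP[_ iin]].
have iJ : (i <= J)%N by apply: leq_trans thJ; rewrite -ltnS.
rewrite /kappa; case om: (omin _) => [k|]; last first.
  by move/ominNone : om => /(_ i); rewrite (eqP iin).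
move/ominSome : om => [kn kmin].
have kJ : (k <= J)%N.
  rewrite leqNgt; apply/negP => Jk.
  by apply: (kmin i); [exact: leq_ltn_trans Jk|rewrite (eqP iin)].
by exists k; split; rewrite ?rhoK//; rewrite -(rhoK k kJ) -kn /word rhoK.
Qed.

Lemma cardN_eventually : \forall n \near \oo, 1 - eps <= (cardN chi x eps n)%:R / n%:R :> R.
Proof.
have [j0 j0dense j0min] := @ex_minnP dense (ex_intro _ J (ltW freq_words_J)).
have j0J : (j0 <= J)%N by apply: j0min; exact: ltW.
have thetaj0 := @theta_between j0 (fun j jj0 => ltac:(
  by apply/negP => /j0min; rewrite leqNgt jj0)).
have [N _ NN] := filterI rho_upto thetaj0.
have count n : (hit_count (words j0) x n <= cardN chi x eps n + maxn N Kmax)%N.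
  rewrite /cardN (card_ord_pred n (inN chi x eps)).
  apply: (sum_bool_le (a := fun l : nat => hits (words j0) x l%:Z)
    (b := inN chi x eps)) => l _.
  rewrite geq_max => /andP[Nl Kl] /hits_wordsP[i ij il].
  have [rhoK /andP[jth _]] := NN l Nl.
  apply/existsP; exists (Ordinal (leq_trans ij jth : (i < (theta chi x eps l).+1)%N)).
  have iJ := leq_trans ij j0J.
  by rewrite /inA/= rhoK// il eqxx leqnn !andbT (leq_trans (leKmax iJ)).
have eps_lt : 1 - eps < freq (words j0) by move: j0dense eps0; rewrite /dense; lra.
have nN : \forall n \near \oo, (1 - eps) * n%:R < (cardN chi x eps n)%:R :> R.
  by apply: (frequency_gt (@freqP (words j0)) eps_lt); exact: nearW count.
near=> n; rewrite ler_pdivlMr ?ltr0n; last by near: n; exact: nbhs_infty_gt.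
by apply: ltW; near: n.
Unshelve. all: by end_near. Qed.

Lemma occurrences_eventually g : 0 < g -> \forall n \near \oo, forall i, (i <= J)%N ->
  n%:R `^ (1 - g) <= (occurrences x (word i) n)%:R :> R.
Proof.
move=> g0; apply: (near_forall_lt
  (W := fun i n => n%:R `^ (1 - g) <= (occurrences x (word i) n)%:R) J.+1) => i.
have half : freq [:: word i] / 2 < freq [:: word i].
  by have := freq_word_gt0 i; lra.
have count n : (hit_count [:: word i] x n <= occurrences x (word i) n + K i)%N.
  rewrite /occurrences (card_ord_pred n.+1 (fun j =>
    (size (word i) <= j.+1)%N && (block x j%:Z (size (word i)) == word i))).
  apply: (@leq_trans (hit_count [:: word i] x n.+1)).
    by rewrite /hit_count big_ord_recr leq_addr.
  apply: (sum_bool_le (a := fun l : nat => hits [:: word i] x l%:Z) (b := fun j : nat =>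
    (size (word i) <= j.+1)%N && (block x j%:Z (size (word i)) == word i))) => l _ Kl.
  by rewrite hits1 size_tilde_block => ->; rewrite andbT leqW.
have : \forall n \near \oo,
    freq [:: word i] / 2 * n%:R < (occurrences x (word i) n)%:R.
  by apply: (frequency_gt (@freqP [:: word i]) half); exact: nearW count.
have a0 : 0 < freq [:: word i] / 2 by rewrite divr_gt0.
apply: filterS2 (powR_sublinear g0 a0) => n le1 /ltW; exact: le_trans.
Qed.

End Scheme.

(** * The law of the process on path space, and the theorem *)

Section Canonical.
Context (R : realType) (d : measure_display) (Omega : measurableType d)
  (P : probability Omega R) (S : countType) (X : int -> Omega -> S).
Variable s0 : S.
Hypothesis mX : measurable_process X.
Local Notation PS := (path_space s0).

Definition path_map (o : Omega) : PS := X^~ o.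

Lemma measurable_path_map : measurable_fun setT path_map.
Proof. exact: measurable_into_path. Qed.

HB.instance Definition _ := isMeasurableFun.Build _ _ _ _ path_map measurable_path_map.

Definition path_law : probability PS R := distribution P path_map.

Lemma path_law_stationary : stationary_process P X ->
  forall B, measurable B -> path_law ((shift_path 1 : PS -> PS) @^-1` B) = path_law B.
Proof. exact. Qed.

Lemma path_law_ergodic : ergodic_process P X ->
  forall B, measurable B -> (shift_path 1 : PS -> PS) @^-1` B = B ->
    path_law B = 0%E \/ path_law B = 1%E.
Proof. exact. Qed.

Lemma path_law_ae (W : PS -> Prop) :
  {ae path_law, forall x, W x} -> {ae P, forall o, W (X^~ o)}.
Proof.
move=> [N [mN N0 WN]]; exists (path_map @^-1` N); split=> //.
- by rewrite -[X in measurable X]setTI; exact: measurable_path_map.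
- by move=> o /= /WN.
Qed.

Lemma ae_path_law (W : set PS) : measurable W ->
  {ae P, forall o, W (X^~ o)} -> {ae path_law, forall x, W x}.
Proof.
move=> mW aeW; apply/negligibleP; first exact: measurableC.
apply: (measure_negligible _ aeW).
rewrite -[X in measurable X]/(path_map @^-1` (~` W)) -[X in measurable X]setTI.
by apply: measurable_path_map => //; exact: measurableC.
Qed.

Lemma memory_bound_block x y K : block x 0 K = block y 0 K ->
  memory_bound P X x K -> memory_bound P X y K.
Proof. by rewrite /memory_bound => ->. Qed.

(** A bound on the memory that is at most [K] is decided by a suffix of the last [K]
    symbols; so is the minimality of [K]. *)
Lemma memory_length_block x y K : block x 0 K = block y 0 K ->
  memory_length P X x = Some K -> memory_length P X y = Some K.
Proof.
move=> xy /ominSome[xK xmin]; apply/ominSome; split.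
  exact: memory_bound_block xK.
move=> m mK /(memory_bound_block (esym (block_suffix (ltnW mK) xy))).
exact: xmin.
Qed.

End Canonical.

Section Typical.
Context (R : realType) (S : countType).
Variable is_memory : (int -> S) -> nat -> Prop.
Hypothesis is_memory_block : forall x y k,
  block x 0 k = block y 0 k -> is_memory x k -> is_memory y k.
Hypothesis is_memory_inj : forall x k l, is_memory x k -> is_memory x l -> k = l.

(** The almost sure properties of a sample path from which the asymptotics
    follow without further probability: [K i] is the memory length of the
    [i]-th reconstructed past, and its memory word is
    [tilde_block x i (K i)]. *)
Definition typical_path (chi : nat -> seq S -> nat) (eps : R) (x : int -> S) : Prop :=
  exists (K : nat -> nat) (freq : seq (seq S) -> R) (J : nat),
  [/\ (forall i n, zeta x i n <> None),
      (forall i, memory_word is_memory (tilde_block x i (K i)) /\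
        \forall n \near \oo, chi n (tilde_block x i n.+1) = K i),
      (forall F, (hit_count F x n)%:R / n%:R @[n --> \oo] --> freq F),
      (forall i, 0 < freq [:: tilde_block x i (K i)])
    & 1 - eps / 2 < freq [seq tilde_block x i (K i) | i <- iota 0 J.+1]].

(** A memory word seen at the end of a reconstructed past is its whole memory
    word, because the memory word of a past is unique. *)
Lemma words_reached (x : int -> S) (K : nat -> nat) (F : seq (seq S)) :
  (forall i, memory_word is_memory (tilde_block x i (K i))) ->
  (forall w, w \in F ->
     memory_word is_memory w /\ exists i, tilde_block x i (size w) = w) ->
  exists J, {subset F <= [seq tilde_block x i (K i) | i <- iota 0 J.+1]}.
Proof.
move=> xK; elim: F => [|w F IH] Fx; first by exists 0%N.
have [J JF] := IH (fun v vF => Fx v (mem_behead (s := w :: F) vF)).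
have [mw [i iw]] := Fx w (mem_head w F).
have Ki : K i = size w.
  by apply: (tilde_memory_word_inj is_memory_block is_memory_inj (x := x) (i := i));
    rewrite ?iw.
exists (maxn i J) => v; rewrite inE => /predU1P[->|/JF /mapP[j jJ ->]]; apply/mapP.
  by exists i; rewrite ?Ki// mem_iota ltnS leq_maxl.
exists j => //; move: jJ; rewrite !mem_iota/= !add0n !ltnS => jJ.
by rewrite (leq_trans jJ)// leq_maxr.
Qed.

Variable s0 : S.
Local Notation PS := (path_space s0).
Local Notation T := (shift_path 1 : PS -> PS).
Variable Q : probability PS R.
Hypothesis QT : forall B, measurable B -> Q (T @^-1` B) = Q B.
Hypothesis ergT : forall B, measurable B -> T @^-1` B = B -> Q B = 0%E \/ Q B = 1%E.

Lemma ae_typical_path (chi : nat -> seq S -> nat) (eps : R) : 0 < eps ->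
  {ae Q, forall x : PS, \forall n \near \oo, is_memory x (chi n (block x 0 n.+1))} ->
  {ae Q, forall x : PS, typical_path chi eps x}.
Proof.
move=> eps0 aechi.
have ae_is_memory : {ae Q, forall x : PS, exists k, is_memory x k}.
  by apply: filterS aechi => x [n _ /(_ n (leqnn n)) nx]; exists (chi n (block x 0 n.+1)).
have eps20 : 0 < eps / 2 by rewrite divr_gt0.
have [F [goodF freqF]] := memory_words_exhaust is_memory_block ae_is_memory eps20.
have ae_finite := ae_zeta_finite QT.
have ae_freq := ae_hit_count_freq QT ergT.
have ae_gt0 := ae_tilde_word_freq_gt0 QT.
have ae_found := ae_tilde_word_found QT ergT.
have ae_memory := ae_tilde_memory QT is_memory_block is_memory_inj aechi.
have : {ae Q, forall x : PS, [/\
    forall i n, zeta x i n <> None,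
    forall F, (hit_count F x n)%:R / n%:R @[n --> \oo] --> word_freq Q F,
    forall i k, 0 < word_freq Q [:: tilde_block x i k],
    forall w, 0 < word_freq Q [:: w] -> exists i, tilde_block x i (size w) = w
    & forall i, exists2 k, memory_word is_memory (tilde_block x i k) &
      \forall n \near \oo, chi n (tilde_block x i n.+1) = k]}.
  by near=> x; split; near: x.
apply: filterS => x [zfin freqP freq_gt0 found xmem].
have /choice[K xK] : forall i, exists k, memory_word is_memory (tilde_block x i k) /\
    \forall n \near \oo, chi n (tilde_block x i n.+1) = k.
  by move=> i; have [k] := xmem i; exists k.
have [J FJ] : exists J, {subset F <= [seq tilde_block x i (K i) | i <- iota 0 J.+1]}.
  apply: words_reached => [i|w wF]; first by have [] := xK i.
  by have [mw w0] := goodF w wF; split=> //; exact: found.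
exists K, (word_freq Q), J; split=> //.
exact: lt_le_trans freqF (word_freq_homo Q FJ).
Unshelve. all: by end_near. Qed.

End Typical.

Theorem theorem5 (R : realType) (d : measure_display) (Omega : measurableType d)
    (P : probability Omega R) (S : countType) (X : int -> Omega -> S)
    (gamma eps : R) (chi : nat -> seq S -> nat)
    (hX : stationary_ergodic_FM P X)
    (hgamma : 0 < gamma < 1)
    (hchi : consistent_backward_estimator R chi)
    (heps : 0 < eps) :
  [/\ {ae P, forall o, \forall n \near \oo, inN chi (X^~ o) eps n ->
        Some (rho chi (X^~ o) n (kappa chi (X^~ o) n)) =
          memory_length P X (shift_path n%:Z (X^~ o))},
      {ae P, forall o,
        ((1 - eps)%:E <=
          limn_einf (fun n => ((cardN chi (X^~ o) eps n)%:R / n%:R)%:E))%E}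
    & {ae P, forall o, \forall n \near \oo, inN chi (X^~ o) eps n ->
        n%:R `^ (1 - gamma) <=
          (occurrences (X^~ o)
             (block (X^~ o) n%:Z (rho chi (X^~ o) n (kappa chi (X^~ o) n)))
             n)%:R :> R}].
Proof.
have [mX statX ergX _] := hX; have /andP[gamma0 _] := hgamma.
pose s0 := X 0 point; pose Q := path_law P s0 mX.
pose is_memory x k := memory_length P X x = Some k.
have is_memory_block : forall x y k,
    block x 0 k = block y 0 k -> is_memory x k -> is_memory y k.
  by move=> x y k; exact: memory_length_block.
have is_memory_inj : forall x k l, is_memory x k -> is_memory x l -> k = l.
  by move=> x k l; rewrite /is_memory => -> [].
have aechi : {ae Q, forall x : path_space s0,
    \forall n \near \oo, is_memory x (chi n (block x 0 n.+1))}.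
  apply: (ae_path_law mX (measurable_estimate_correct s0 is_memory_block chi)).
  have := hchi _ _ _ _ hX; apply: filterS => o; apply: filterS => n on.
  by rewrite /is_memory -on.
have : {ae P, forall o, typical_path is_memory chi eps (X^~ o)}.
  apply: (path_law_ae (ae_typical_path is_memory_block is_memory_inj _ _ heps aechi)).
    exact: path_law_stationary.
  exact: path_law_ergodic.
move=> typ; split; apply: filterS typ => o; move: (X^~ o) => x {o};
  move=> [K [freq [J [zfin xK freqP freq_gt0 freqJ]]]];
  have chiK i : \forall n \near \oo, chi n (tilde_block x i n.+1) = K i by have [] := xK i.
- apply: filterS (kappa_eventually zfin chiK freqP freqJ) => n kn /kn[i [iJ -> -> ni]].
  apply/esym; apply: ((memory_wordP is_memory_block _ _).1).
  by rewrite block_shift add0r ni; have [] := xK i.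
- apply: limn_einf_ge; exact: (cardN_eventually heps zfin chiK freqP freqJ).
- have kn := kappa_eventually zfin chiK freqP freqJ.
  have occ := occurrences_eventually freqP freq_gt0 J gamma0.
  by apply: filterS2 kn occ => n kn occn /kn[i [iJ -> -> ->]]; exact: occn.
Qed.
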